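(* Let $n\geq r\geq 2$ and let $C\in\mathbb{R}^{n\times n}$ be row-stochastic, reducible, and with zero diagonal. Let $\{1,\dots,r\}$ be the set of globally reachable nodes of $G(C)$, and let $G(C_r)$ be the subgraph of $G(C)$ induced by the globally reachable nodes. Consider the single-timescale DF dynamical system $x(t+1)=F(x(t))$ on $\Delta_n$, where $F(x)=C^\top(x-x^2)+x^2$. Then the set of equilibrium points of $F$ is $\{e_1,\dots,e_n,x^*\}$, where $x^*\in\Delta_n$ has the following properties: (i) if $r=2$, then $x^*$ stands for the family of points $(\alpha,1-\alpha,0,\dots,0)^\top$ with arbitrary $\alpha\in[0,1]$ (so the set of equilibria is $\{e_1,\dots,e_n\}\cup\{(\alpha,1-\alpha,0,\dots,0)^\top:\alpha\in[0,1]\}$), and for every non-autocratic initial condition $x(0)\in\Delta_n\setminus\{e_1,\dots,e_n\}$ the self-weights $x(t)$ converge exponentially to a point of this family; (ii) if $r\geq 3$ and $G(C_r)$ has star topology with center node $1$, then $x^*=e_1$, and for every non-autocratic $x(0)\in\Delta_n\setminus\{e_1,\dots,e_n\}$ the self-weights $x(t)$ converge asymptotically to $e_1$; (iii) if $r\geq 3$ and $G(C_r)$ does not have star topology, then $x^*\in\Delta_n\setminus\{e_1,\dots,e_n\}$ satisfies: 1) $x_i^*>0$ for $i\in\{1,\dots,r\}$ and $x_j^*=0$ for $j\in\{r+1,\dots,n\}$, and 2) the ranking of the entries of $x^*$ is equal to the ranking of the entries of the vector $c$ of eigenvector centrality scores; moreover, for every non-autocratic $x(0)\in\Delta_n\setminus\{e_1,\dots,e_n\}$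 the self-weights $x(t)$ converge exponentially to $x^*$.
   Context: $\Delta_n=\{x\in\mathbb{R}^n : x_i\geq 0 \text{ for all } i,\ \sum_i x_i=1\}$ is the simplex and $e_1,\dots,e_n$ are the standard basis vectors of $\mathbb{R}^n$ (autocratic configurations). For a vector $x$, $x^2=(x_1^2,\dots,x_n^2)^\top$ is the entrywise square. A matrix is row-stochastic if its entries are non-negative and each row sums to $1$. The digraph $G(C)$ has nodes $\{1,\dots,n\}$ and a directed edge $(i,j)$ whenever $c_{ij}>0$; $C$ is reducible if and only if $G(C)$ is not strongly connected. A node is globally reachable if it can be reached by a directed path from every other node. A digraph has star topology with center node $i$ if every directed edge is either from node $i$ or to node $i$. When $G(C)$ has a globally reachable node, $C$ has a unique dominant left eigenvector $c^\top$, i.e. a unique row vector with $c^\top C=c^\top$ and $c\in\Delta_n$; the entries of $c$ are the eigenvector centrality scores. Equal ranking of the entries of $x^*$ and $c$ means: for all $i,j$, $x_i^*>x_j^*$ if and only if $c_i>c_j$. Exponential convergence $x(t)\to \bar x$ means there exist $M>0$ and $\rho\in(0,1)$ (possibly depending on the trajectory) with $\|x(t)-\bar x\|\leq M\rho^t$ for all $t\geq 0$. *)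

(* Defs.v *)
From HB Require Import structures.
From mathcomp Require Import all_boot all_order all_algebra.
From mathcomp Require Import all_classical all_reals all_analysis.

Set Implicit Arguments.
Unset Strict Implicit.
Unset Printing Implicit Defensive.

Import Order.TTheory GRing.Theory Num.Theory.
Import numFieldNormedType.Exports.

Local Open Scope classical_set_scope.
Local Open Scope ring_scope.

Section Digraph.
Variable T : finType.
Implicit Type e : rel T.

Definition strongly_connected e : Prop := forall i j : T, connect e i j.

Definition globally_reachable e (i : T) : bool :=
  [forall j : T, (j != i) ==> connect e j i].

Definition globally_reachable_nodes e : {set T} :=
  [set i : T | globally_reachable e i]%SET.

(* The node type of the induced subgraph is the subtype of the elements of V,
   so that a center of the subgraph is necessarily one of its nodes. *)
Definition induced_subgraph e (V : {set T}) : rel {i : T | i \in V} :=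
  relpre val e.

Definition star_topology e (k : T) : Prop :=
  forall i j : T, e i j -> i = k \/ j = k.

End Digraph.

Arguments induced_subgraph {T} e V _ _.

Section DeGrootFriedkin.
Variables (R : realType) (n : nat).
Implicit Types (C : 'M[R]_n) (x y c : 'cV[R]_n).

Definition simplex : set 'cV[R]_n :=
  [set x | (forall i, 0 <= x i 0) /\ \sum_i x i 0 = 1].

Definition autocratic : set 'cV[R]_n :=
  range (fun i : 'I_n => delta_mx i 0 : 'cV[R]_n).

Definition row_stochastic C : Prop :=
  (forall i j, 0 <= C i j) /\ (forall i, \sum_j C i j = 1).

Definition digraph C : rel 'I_n := [rel i j | 0 < C i j].

Definition reducible C : Prop := ~ strongly_connected (digraph C).

Definition dominant_left_eigenvector C c : Prop :=
  c^T *m C = c^T /\ simplex c.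

Definition entrywise_square x : 'cV[R]_n := map_mx (fun a => a ^+ 2) x.

Definition DF_map C x : 'cV[R]_n :=
  C^T *m (x - entrywise_square x) + entrywise_square x.

Definition self_weights C x (t : nat) : 'cV[R]_n := iter t (DF_map C) x.

Definition equilibria C : set 'cV[R]_n :=
  [set x | simplex x /\ DF_map C x = x].

(* (a, 1 - a, 0, ..., 0)^T *)
Definition two_node_point (a : R) : 'cV[R]_n :=
  \col_i (if val i == 0%N then a else if val i == 1%N then 1 - a else 0).

Definition two_node_family : set 'cV[R]_n :=
  [set two_node_point a | a in [set a : R | 0 <= a <= 1]].

Definition same_ranking x y : Prop :=
  forall i j : 'I_n, (y j 0 < y i 0) <-> (x j 0 < x i 0).

(* `|_| on 'cV[R]_n is the max norm; all norms being equivalent, only M depends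
   on this choice. *)
Definition converges_exponentially (u : nat -> 'cV[R]_n) (l : 'cV[R]_n) : Prop :=
  exists M rho : R, [/\ 0 < M, 0 < rho < 1 &
    forall t : nat, `|u t - l| <= M * rho ^+ t].

End DeGrootFriedkin.

Arguments simplex {R n}.
Arguments autocratic {R n}.
Arguments two_node_family {R n}.

(* Main.v *)
Require Import Defs.
From HB Require Import structures.
From mathcomp Require Import all_boot all_order all_algebra.
From mathcomp Require Import all_classical all_reals all_analysis.
From mathcomp Require Import ring lra zify.

Set Implicit Arguments.
Unset Strict Implicit.
Unset Printing Implicit Defensive.

Import Order.TTheory GRing.Theory Num.Theory.
Import numFieldNormedType.Exports.

Local Open Scope classical_set_scope.
Local Open Scope ring_scope.

(** Call [outflow x i = x_i (1 - x_i)] the mass that node [i] redistributes along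
    its edges.  The map moves a configuration by [(C^T - 1) outflow x], so that
    [x] is an equilibrium exactly when [outflow x] is a multiple of the
    centrality vector [c].  This vector is positive on the set [S] of globally
    reachable nodes, the recurrent class of the chain, and 0 elsewhere.

    Equilibria.  If [S] has at least three nodes, a non-autocratic equilibrium is
    positive exactly on [S], is ranked like [c] (fixed_ranking), and can exist
    only if every centrality is less than 1/2 (fixed_centrality_lt_half), that is
    when the subgraph on [S] is no star (star_centrality, half_centrality_star).
    It is unique (fixed_unique): the share of what the most central node leaves
    would otherwise decrease strictly for all other nodes.

    Convergence.  The sum over [S] of [(x_i^2 / 2 - x_i^3 / 3) / c_i], plus a
    multiple of the transient mass weighted by the hitting times of [S], is a
    Lyapunov function (lyapunov_dissipation): the time-reversed chain contracts
    the densities [outflow x i / c_i], which absorbs the second-order terms of the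
    increment and leaves a dissipation that is at least cubic in the step.  Hence
    the steps of an orbit tend to 0 and, by compactness, orbits accumulate only at
    equilibria.
    Autocratic ones are avoided: the mass weighted by the hitting times of a node
    [i] of [S] changes in one step by [outflow x i / c_i] minus the total outflow,
    so it grows next to [e_i] as soon as [c_i] is less than 1/2
    (autocrat_repels), and for [i] outside [S] the class [S] eventually holds a
    fixed amount of mass (transient_mass_bounded).  So the orbit of a
    non-autocratic configuration tends to the center of the star, if there is one;
    otherwise it tends to a non-autocratic equilibrium, whose existence is thereby
    proved as well.

    Rate.  A non-autocratic equilibrium is nondegenerate (nondegenerate), so near
    it the deviation is bounded by the step (deviation_le_defect).  The Lyapunov
    function exceeds its limit by a quadratic quantity only, and it decreases by a
    quadratic quantity at each step (near_equilibrium); it therefore converges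
    geometrically, and so does the orbit.  When [S] has two nodes they swap their
    outflows, and their shares change only by amounts that are summable thanks to
    the geometric decay of the transient mass (two_node_convergence). *)

(** * Hitting times of a finite Markov chain *)

Section HittingTimes.
Variables (R : realType) (n : nat) (C : 'M[R]_n).
Hypothesis Cstoch : row_stochastic C.

Lemma stoch_ge0 i j : 0 <= C i j. Proof. exact: (Cstoch.1). Qed.

Lemma stoch_sum1 i : \sum_j C i j = 1. Proof. exact: (Cstoch.2). Qed.

(** Summation by parts: mass flowing along the edges changes a weighted total
    mass by the gain of weight along each edge. *)
Lemma flow_pairing (w ze : 'I_n -> R) :
  \sum_j w j * (\sum_k C k j * ze k - ze j) =
  \sum_k ze k * (\sum_j C k j * w j - w k).
Proof.
under eq_bigr do rewrite mulrBr mulr_sumr.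
under [RHS]eq_bigr do rewrite mulrBr mulr_sumr.
rewrite !sumrB exchange_big /=; congr (_ - _).
  by apply: eq_bigr => k _; apply: eq_bigr => j _; ring.
by apply: eq_bigr => k _; ring.
Qed.

Variable A : {set 'I_n}.
Hypothesis reachA : forall j, exists2 i, i \in A & connect (digraph C) j i.

(** A positive maximum would be attained at all out-neighbours of a point where it
    is attained, and so, along a path, in [A]. *)
Lemma max_principle (w : 'I_n -> R) :
    (forall k, k \in A -> w k <= 0) ->
    (forall k, k \notin A -> w k <= \sum_j C k j * w j) ->
  forall k, w k <= 0.
Proof.
move=> wA wnA k; rewrite leNgt; apply/negP => wk.
pose p := [arg max_(i > k) w i]%O.
have maxp j : w j <= w p.
  by rewrite /p; case: arg_maxP => // i _ /(_ j isT).
have wp : 0 < w p by apply: lt_le_trans wk (maxp k).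
have [i iA /connectP[s ps def_i]] := reachA p.
have spread (a b : 'I_n) : w a = w p -> digraph C a b -> w b = w p.
  move=> wa Cab; apply/eqP; rewrite eq_le maxp /= leNgt; apply/negP => ltb.
  have aNA : a \notin A by apply/negP => /wA; rewrite wa leNgt wp.
  have /= := wnA a aNA; rewrite wa leNgt => /negP; apply.
  rewrite -[ltRHS]mul1r -(stoch_sum1 a) mulr_suml.
  rewrite (bigD1 b) //= [ltRHS](bigD1 b) //=.
  apply: ltr_leD; first by rewrite ltr_pM2l.
  by apply: ler_sum => j _; rewrite ler_wpM2l ?stoch_ge0.
have wi : w i = w p.
  have : w p = w p by [].
  move: def_i ps; move: {1 2 3}p => a -> {i iA}.
  elim: s a => [//|b s IH] a /= /andP[Cab ps] wa.
  exact: IH (spread _ _ wa Cab).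
by have := wA i iA; rewrite wi leNgt wp.
Qed.

(** Expected hitting times of [A]: the system they solve is nonsingular because
    a solution of the homogeneous system and its opposite both satisfy the
    maximum principle. *)
Lemma hitting_times_exist : exists w : 'I_n -> R,
  [/\ forall k, 0 <= w k, forall k, k \in A -> w k = 0 &
      forall k, k \notin A -> w k = 1 + \sum_j C k j * w j].
Proof.
pose B := \matrix_(k, j) ((k == j)%:R - (k \notin A)%:R * C k j) : 'M[R]_n.
have BE (v : 'I_n -> R) k :
    \sum_j B k j * v j = v k - (k \notin A)%:R * \sum_j C k j * v j.
  rewrite mulr_sumr (eq_bigr
    (fun j => (k == j)%:R * v j - (k \notin A)%:R * (C k j * v j))).
    rewrite sumrB (bigD1 k) //= eqxx mul1r big1 ?addr0 //.
    by move=> j jk; rewrite eq_sym (negbTE jk) mul0r.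
  by move=> j _; rewrite mxE; ring.
have Bunit : B \in unitmx.
  rewrite unitmxE unitfE -det_tr; apply/negP => /det0P[v vn0 /rowP vB].
  have vE k : v 0 k = (k \notin A)%:R * \sum_j C k j * v 0 j.
    have := vB k; rewrite !mxE => vBk; apply/eqP; rewrite -subr_eq0 -BE.
    by rewrite -[X in _ == X]vBk; apply/eqP/eq_bigr => j _; rewrite !mxE mulrC.
  have vle k : v 0 k <= 0.
    move: k; apply: max_principle => k; first by rewrite vE => ->; rewrite mul0r.
    by rewrite {1}vE => ->; rewrite mul1r.
  have vge k : - v 0 k <= 0.
    move: k; apply: (max_principle (w := fun k => - v 0 k)) => k.
      by rewrite vE => ->; rewrite mul0r oppr0.
    move=> kA; rewrite {1}vE kA mul1r -sumrN.
    by apply: ler_sum => j _; rewrite mulrN.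
  move/negP: vn0; apply; apply/eqP/rowP => k; rewrite mxE; apply/eqP.
  by rewrite eq_le vle -oppr_le0 vge.
pose w := invmx B *m (\col_k (k \notin A)%:R).
have wE k : w k 0 = (k \notin A)%:R * (1 + \sum_j C k j * w j 0).
  have /colP/(_ k) : B *m w = \col_k (k \notin A)%:R by rewrite mulKVmx.
  rewrite [LHS]mxE [RHS]mxE (BE (fun j => w j 0)) => /eqP.
  by rewrite subr_eq mulrDr mulr1 => /eqP.
exists (fun k => w k 0); split=> k; last 2 first.
- by rewrite wE => ->; rewrite mul0r.
- by move=> kA; rewrite {1}wE kA mul1r.
rewrite -oppr_le0; move: k.
apply: (max_principle (w := fun k => - w k 0)) => k kA.
  by rewrite wE kA mul0r oppr0.
rewrite {1}wE kA mul1r opprD -sumrN.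
under eq_bigr do rewrite -mulrN.
by rewrite gerDr oppr_le0.
Qed.

End HittingTimes.

(** * The recurrent class and its stationary vector *)

Section Centrality.
Variables (R : realType) (n : nat) (C : 'M[R]_n).
Hypothesis Cstoch : row_stochastic C.

Let S := globally_reachable_nodes (digraph C).

Lemma sink_reach i j : i \in S -> connect (digraph C) j i.
Proof.
rewrite inE => /forallP/(_ j)/implyP; case: (eqVneq j i) => [-> _|_ ->//].
exact: connect0.
Qed.

Lemma sink_closed i j : i \in S -> j \notin S -> C i j = 0.
Proof.
move=> iS jS; apply/eqP; rewrite eq_le stoch_ge0 // andbT leNgt.
apply: contra jS => Cij; rewrite inE; apply/forallP => k; apply/implyP => _.
by apply: connect_trans (sink_reach k iS) _; apply: connect1.
Qed.

Lemma sink_row_sum i : i \in S -> \sum_(j in S) C i j = 1.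
Proof.
move=> iS; rewrite -(stoch_sum1 Cstoch i) [RHS](bigID (mem S)) /=.
by rewrite [X in _ + X]big1 ?addr0 // => j; exact: sink_closed.
Qed.

(** The entrywise absolute value of a left fixed vector of [C] is again fixed:
    it is dominated by its image and has the same total mass. *)
Lemma dominant_left_eigenvector_exists (i0 : 'I_n) :
  exists c, dominant_left_eigenvector C c.
Proof.
have [v vn0 vC] : exists2 v : 'rV[R]_n, v != 0 & v *m (C - 1%:M) = 0.
  apply/det0P; rewrite -[_ == _]negbK -unitfE -unitmxE; apply/negP => unitB.
  have /(congr1 (mulmx (invmx (C - 1%:M)))) :
      (C - 1%:M) *m const_mx 1 = 0 :> 'cV[R]_n.
    apply/colP => k; rewrite mulmxBl mul1mx !mxE.
    by under eq_bigr do rewrite mxE mulr1; rewrite stoch_sum1 // subrr.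
  rewrite mulKmx // mulmx0 => /colP/(_ i0); rewrite !mxE => /eqP.
  by rewrite oner_eq0.
have vE k : v 0 k = \sum_j v 0 j * C j k.
  move/rowP/(_ k): vC; rewrite mulmxBr mulmx1 !mxE => /eqP.
  by rewrite subr_eq0 => /eqP.
pose a k := `|v 0 k|.
have a_ge0 k : 0 <= a k by exact: normr_ge0.
have a_le k : a k <= \sum_j a j * C j k.
  rewrite /a {1}vE; apply: le_trans (ler_norm_sum _ _ _) _.
  by apply: ler_sum => j _; rewrite normrM (ger0_norm (stoch_ge0 _ _ _)).
have aE k : \sum_j a j * C j k = a k.
  apply/eqP; rewrite -subr_eq0; apply/eqP; move: k (isT).
  apply: psumr_eq0P => [k _|]; first by rewrite subr_ge0.
  rewrite sumrB exchange_big /=; apply/eqP; rewrite subr_eq0; apply/eqP.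
  by apply: eq_bigr => j _; rewrite -mulr_sumr stoch_sum1 ?mulr1.
have sa : 0 < \sum_k a k.
  rewrite lt_def sumr_ge0 // andbT; apply: contra vn0 => /eqP s0.
  apply/eqP/rowP => k; rewrite mxE; apply/eqP; rewrite -normr_eq0; apply/eqP.
  by apply: (psumr_eq0P _ s0) => // j _; exact: a_ge0.
exists (\col_k (a k / \sum_k a k)); split.
  apply/rowP => k; rewrite !mxE -[in RHS](aE k) mulr_suml.
  by apply: eq_bigr => j _; rewrite !mxE; ring.
split=> [k|]; first by rewrite mxE divr_ge0 // ltW.
by under eq_bigr do rewrite mxE; rewrite -mulr_suml divff ?gt_eqF.
Qed.

Lemma dominant_fixed c k : dominant_left_eigenvector C c ->
  \sum_j C j k * c j 0 = c k 0.
Proof.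
move=> [/rowP/(_ k) + _]; rewrite !mxE => <-.
by apply: eq_bigr => j _; rewrite mxE mulrC.
Qed.

(** Take for [w] the hitting times of [i].  Moving one unit of mass one step
    along the chain lowers the [w]-weighted mass by 1, except at [i], where it
    raises it by the mean return time minus 1.  At the stationary flow [c] the
    total change is 0, which identifies the mean return time with the inverse of
    the centrality (Kac's formula). *)
Lemma hitting_time_flow c i : dominant_left_eigenvector C c -> i \in S ->
  0 < c i 0 /\
  exists w : 'I_n -> R, [/\ forall k, 0 <= w k, w i = 0,
    forall k, k != i -> 1 <= w k &
    forall ze : 'I_n -> R, \sum_j w j * (\sum_k C k j * ze k - ze j) =
      ze i / c i 0 - \sum_k ze k].
Proof.
move=> cdom iS.
have reach j : exists2 k, k \in [set i]%SET & connect (digraph C) j k.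
  by exists i; [rewrite inE|apply: sink_reach].
have [w [w0 wi wN]] := hitting_times_exist Cstoch reach.
have wi0 : w i = 0 by apply: wi; rewrite inE.
pose m := \sum_j C i j * w j.
have m0 : 0 <= m by apply: sumr_ge0 => j _; rewrite mulr_ge0 ?stoch_ge0.
have flow (ze : 'I_n -> R) : \sum_j w j * (\sum_k C k j * ze k - ze j) =
      ze i * (1 + m) - \sum_k ze k.
  rewrite flow_pairing (bigD1 i) //= wi0 subr0 -/m [in RHS](bigD1 i) //=.
  rewrite (eq_bigr (fun k => - ze k)); first by rewrite sumrN; ring.
  by move=> k ki; rewrite (wN k) ?inE //; ring.
have c1 : c i 0 * (1 + m) = 1.
  have := flow (fun k => c k 0); rewrite big1 => [/esym/eqP|j _].
    by rewrite subr_eq0 cdom.2.2 => /eqP.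
  by rewrite dominant_fixed // subrr mulr0.
have m1 : 0 < 1 + m by lra.
have m1_neq0 : 1 + m != 0 by rewrite gt_eqF.
have ci : c i 0 = (1 + m)^-1 by apply: (mulIf m1_neq0); rewrite c1 mulVf.
split; first by rewrite ci invr_gt0.
exists w; split=> // [k ki|ze]; last by rewrite flow ci invrK.
rewrite (wN k) ?inE // lerDl sumr_ge0 // => j _.
by rewrite mulr_ge0 ?stoch_ge0.
Qed.

(** Here the weights are the hitting times of the whole recurrent class, which
    its own flow never leaves. *)
Lemma sink_hitting_flow (i0 : 'I_n) (i0S : i0 \in S) :
  exists h : 'I_n -> R, [/\ forall k, 0 <= h k, forall k, k \in S -> h k = 0,
    forall k, k \notin S -> 1 <= h k &
    forall ze : 'I_n -> R, \sum_j h j * (\sum_k C k j * ze k - ze j) =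
      - \sum_(k | k \notin S) ze k].
Proof.
have reach j : exists2 k, k \in S & connect (digraph C) j k.
  by exists i0 => //; apply: sink_reach.
have [h [h0 hS hN]] := hitting_times_exist Cstoch reach.
exists h; split=> // [k kS|ze].
  rewrite (hN k) // lerDl sumr_ge0 // => j _.
  by rewrite mulr_ge0 ?stoch_ge0.
rewrite flow_pairing (bigID (mem S)) /= big1 ?add0r => [|k kS].
  rewrite -sumrN; apply: eq_bigr => k kS; rewrite (hN k) //; ring.
rewrite hS // subr0 big1 ?mulr0 // => j _.
by have [/hS->|/(sink_closed kS)->] := boolP (j \in S); rewrite ?mulr0 ?mul0r.
Qed.

Lemma dominant_off_sink c i0 k : i0 \in S -> dominant_left_eigenvector C c ->
  k \notin S -> c k 0 = 0.
Proof.
move=> i0S cdom kS; have [h [_ _ _ flow]] := sink_hitting_flow i0S.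
have := flow (fun k => c k 0); rewrite big1 => [/esym/eqP|j _]; last first.
  by rewrite dominant_fixed // subrr mulr0.
rewrite oppr_eq0 => /eqP s0.
by apply: psumr_eq0P s0 k kS => j _; exact: (cdom.2.1).
Qed.

(** The centrality of a node is determined by its return time alone. *)
Lemma dominant_left_eigenvector_unique c i0 : i0 \in S ->
  dominant_left_eigenvector C c -> unique (dominant_left_eigenvector C) c.
Proof.
move=> i0S cdom; split=> // d ddom; apply/colP => k.
have [kS|kS] := boolP (k \in S); last by rewrite !(dominant_off_sink i0S).
have [ck [w [_ _ _ flow]]] := hitting_time_flow cdom kS.
have := flow (fun k => d k 0); rewrite big1 => [/esym/eqP|j _]; last first.
  by rewrite dominant_fixed // subrr mulr0.
by rewrite subr_eq0 ddom.2.2 => /eqP e; rewrite -[LHS]mul1r -e divfK ?gt_eqF.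
Qed.

End Centrality.

(** * The map and its outflows *)

Section Map.
Variables (R : realType) (n : nat) (C : 'M[R]_n).
Hypothesis Cstoch : row_stochastic C.
Implicit Types x : 'cV[R]_n.

Definition outflow x (i : 'I_n) : R := x i 0 * (1 - x i 0).

Lemma DF_mapE x i :
  DF_map C x i 0 = \sum_k C k i * outflow x k + x i 0 ^+ 2.
Proof.
rewrite !mxE; congr (_ + _); apply: eq_bigr => k _; rewrite !mxE /outflow; ring.
Qed.

Lemma DF_incr x i :
  DF_map C x i 0 - x i 0 = \sum_k C k i * outflow x k - outflow x i.
Proof. by rewrite DF_mapE /outflow; ring. Qed.

Lemma simplex_le1 x i : simplex x -> x i 0 <= 1.
Proof.
by move=> [x0 <-]; rewrite (bigD1 i) //= lerDl sumr_ge0.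
Qed.

Lemma simplex_dist_le1 x (y : 'cV[R]_n) i : simplex x -> simplex y ->
  `|x i 0 - y i 0| <= 1.
Proof.
move=> xs ys; have := xs.1 i; have := simplex_le1 i xs.
by have := ys.1 i; have := simplex_le1 i ys; rewrite ler_norml; lra.
Qed.

Lemma simplex_others x i : simplex x -> \sum_(k | k != i) x k 0 = 1 - x i 0.
Proof. by move=> [_ <-]; rewrite [in RHS](bigD1 i) //= addrC addrK. Qed.

Lemma outflow_ge0 x i : simplex x -> 0 <= outflow x i.
Proof.
by move=> xs; rewrite mulr_ge0 ?subr_ge0 ?simplex_le1 //; exact: xs.1.
Qed.

Lemma outflow_le x i : simplex x -> outflow x i <= x i 0.
Proof. by move=> xs; rewrite ler_piMr ?gerBl ?xs.1. Qed.

Lemma inflow_ge0 x i (P : pred 'I_n) : simplex x ->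
  0 <= \sum_(k | P k) C k i * outflow x k.
Proof.
by move=> xs; apply: sumr_ge0 => k _; rewrite mulr_ge0 ?stoch_ge0 ?outflow_ge0.
Qed.

Lemma stoch_le1 i j : C i j <= 1.
Proof.
rewrite -(stoch_sum1 Cstoch i) (bigD1 j) //= lerDl sumr_ge0 // => k _.
exact: stoch_ge0.
Qed.

Lemma inflow_le x i (P : pred 'I_n) : simplex x ->
  \sum_(k | P k) C k i * outflow x k <= \sum_(k | P k) outflow x k.
Proof.
move=> xs; apply: ler_sum => k _.
by rewrite ler_piMl ?outflow_ge0 ?stoch_le1.
Qed.

Lemma simplex_DF x : simplex x -> simplex (DF_map C x).
Proof.
move=> xs; split=> [i|].
  by rewrite DF_mapE addr_ge0 ?sqr_ge0 ?inflow_ge0.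
rewrite -(xs.2) -[LHS](subrK (\sum_i x i 0)) -sumrB.
under eq_bigr do rewrite DF_incr.
rewrite sumrB exchange_big /= (eq_bigr (outflow x)); first by rewrite subrr add0r.
by move=> k _; rewrite -mulr_suml stoch_sum1 ?mul1r.
Qed.

Lemma simplex_delta (i : 'I_n) : simplex (delta_mx i 0 : 'cV[R]_n).
Proof.
split=> [k|]; first by rewrite mxE; case: (_ && _).
rewrite (bigD1 i) //= big1 ?addr0 ?mxE ?eqxx // => k ki.
by rewrite mxE (negbTE ki).
Qed.

Lemma simplex_eq1 x i : simplex x -> x i 0 = 1 -> x = delta_mx i 0.
Proof.
move=> xs xi; apply/colP => k; rewrite mxE eqxx andbT.
case: (eqVneq k i) => [->//|ki].
have s0 : \sum_(k | k != i) x k 0 = 0 by rewrite simplex_others // xi subrr.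
by apply: psumr_eq0P s0 k ki => j _; exact: xs.1.
Qed.

Lemma autocraticP x : simplex x ->
  (~ autocratic x) <-> (forall i, x i 0 < 1).
Proof.
move=> xs; split=> [nx i|lx [i _ xE]].
  rewrite lt_neqAle simplex_le1 // andbT; apply/eqP => xi.
  by apply: nx; exists i => //; rewrite (simplex_eq1 xs xi).
by have := lx i; rewrite -xE mxE !eqxx ltxx.
Qed.

Lemma DF_delta (i : 'I_n) : DF_map C (delta_mx i 0) = delta_mx i 0.
Proof.
apply/colP => k; apply/eqP; rewrite -subr_eq0 DF_incr /outflow.
have z0 j : (delta_mx i 0 : 'cV[R]_n) j 0 * (1 - (delta_mx i 0 : 'cV[R]_n) j 0) = 0.
  by rewrite mxE andbT; case: eqP => _; rewrite /= ?subrr ?mulr0 ?mul0r.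
by rewrite z0 subr0 big1 // => j _; rewrite z0 mulr0.
Qed.

Lemma DF_ge_sqr x i : simplex x -> x i 0 ^+ 2 <= DF_map C x i 0.
Proof. by move=> xs; rewrite DF_mapE lerDr inflow_ge0. Qed.

(** A node keeps at least the square of its weight, so only [e_i] itself is mapped
    to [e_i]. *)
Lemma DF_nonautocratic x : simplex x -> ~ autocratic x ->
  ~ autocratic (DF_map C x).
Proof.
move=> xs nx; have Fs := simplex_DF xs; apply/(autocraticP Fs) => i.
rewrite lt_neqAle simplex_le1 // andbT; apply/eqP => Fi.
have /negP[] : ~~ (x i 0 < 1); last by move/(autocraticP xs): nx.
rewrite -leNgt -subr_le0 -(simplex_others i xs) big1 // => k ki.
have F0 : DF_map C x k 0 = 0.
  by rewrite (simplex_eq1 Fs Fi) mxE (negbTE ki).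
apply/eqP; rewrite -sqrf_eq0 eq_le sqr_ge0 andbT -F0.
exact: DF_ge_sqr.
Qed.

Variable x0 : 'cV[R]_n.
Hypotheses (x0s : simplex x0) (x0n : ~ autocratic x0).

Lemma orbit_simplex t : simplex (self_weights C x0 t).
Proof. by elim: t => [//|t IH]; apply: simplex_DF. Qed.

Lemma orbit_nonautocratic t : ~ autocratic (self_weights C x0 t).
Proof. by elim: t => [//|t IH]; apply: DF_nonautocratic; first exact: orbit_simplex. Qed.

End Map.

(** * The Lyapunov function *)

Section Lyapunov.
Variables (R : realType) (n : nat) (C : 'M[R]_n).
Hypothesis Cstoch : row_stochastic C.
Let S := globally_reachable_nodes (digraph C).
Variable i0 : 'I_n.
Hypothesis i0S : i0 \in S.
Variable c : 'cV[R]_n.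
Hypothesis cdom : dominant_left_eigenvector C c.
(** [h] stands for the hitting times of the recurrent class provided by
    [sink_hitting_flow]. *)
Variable h : 'I_n -> R.
Implicit Types x : 'cV[R]_n.

Definition leak x : R := \sum_(k | k \notin S) outflow x k.

Hypothesis h_flow : forall ze : 'I_n -> R,
  \sum_j h j * (\sum_k C k j * ze k - ze j) = - \sum_(k | k \notin S) ze k.

Lemma centrality_gt0 i : i \in S -> 0 < c i 0.
Proof. by move=> iS; case: (hitting_time_flow Cstoch cdom iS). Qed.

(** The increment of the weight of a node of the recurrent class when the mass
    that enters the class is left out. *)
Definition inner_incr x i : R :=
  \sum_(k in S) C k i * outflow x k - outflow x i.

Lemma leak_ge0 x : simplex x -> 0 <= leak x.
Proof. by move=> xs; apply: sumr_ge0 => k _; apply: outflow_ge0. Qed.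

Lemma DF_split x i : DF_map C x i 0 =
  x i 0 + inner_incr x i + \sum_(k | k \notin S) C k i * outflow x k.
Proof.
rewrite -[LHS](subrK (x i 0)) DF_incr (bigID (mem S)) /= /inner_incr; ring.
Qed.

Lemma transient_mass_decrease x :
  \sum_k h k * DF_map C x k 0 = \sum_k h k * x k 0 - leak x.
Proof.
apply/eqP; rewrite addrC -subr_eq -sumrB /leak -(h_flow (outflow x)).
by apply/eqP/eq_bigr => k _; rewrite -DF_incr; ring.
Qed.

(** Jensen's inequality for the time reversal [c k * C k i / c i] of the chain
    on its recurrent class, applied to the densities [ze k / c k]. *)
Lemma reversed_chain_contraction (ze : 'I_n -> R) :
  \sum_(i in S) (\sum_(k in S) C k i * ze k) ^+ 2 / c i 0 <=
  \sum_(i in S) ze i ^+ 2 / c i 0.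
Proof.
pose q i := \sum_(k in S) C k i * ze k.
have cS i : i \in S -> \sum_(k in S) C k i * c k 0 = c i 0.
  move=> iS; rewrite -(dominant_fixed i cdom) [RHS](bigID (mem S)) /=.
  rewrite [X in _ + X]big1 ?addr0 // => k kS.
  by rewrite (dominant_off_sink Cstoch i0S cdom) ?mulr0.
have jensen i : i \in S ->
    q i ^+ 2 / c i 0 <= \sum_(k in S) C k i * (ze k ^+ 2 / c k 0).
  move=> iS; rewrite -subr_ge0.
  suff <- : \sum_(k in S) C k i * c k 0 * (ze k / c k 0 - q i / c i 0) ^+ 2 =
      \sum_(k in S) C k i * (ze k ^+ 2 / c k 0) - q i ^+ 2 / c i 0.
    apply: sumr_ge0 => k kS.
    apply: mulr_ge0 (sqr_ge0 _); apply: mulr_ge0; first exact: stoch_ge0.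
    by apply: ltW; apply: centrality_gt0.
  rewrite (eq_bigr (fun k => C k i * (ze k ^+ 2 / c k 0)
     + ((- 2 * (q i / c i 0)) * (C k i * ze k)
     + (q i / c i 0) ^+ 2 * (C k i * c k 0)))); last first.
    move=> k kS; field.
    by rewrite !lt0r_neq0 ?centrality_gt0.
  rewrite !big_split /= -!mulr_sumr cS // -/(q i); congr (_ + _).
  by field; apply: lt0r_neq0; apply: centrality_gt0.
apply: (@le_trans _ _
  (\sum_(i in S) \sum_(k in S) C k i * (ze k ^+ 2 / c k 0))).
  by apply: ler_sum => i iS; apply: jensen.
rewrite exchange_big /=; apply: ler_sum => k kS.
by rewrite -mulr_suml sink_row_sum ?mul1r.
Qed.

Definition potential (a : R) : R := a ^+ 2 / 2 - a ^+ 3 / 3.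

(** Large enough for the transient part of the Lyapunov function to compensate
    the effect of the mass entering the class, and 1 more. *)
Definition leak_weight : R := 1 + \sum_(i in S) (c i 0)^-1.

(** [potential] is a primitive of [a * (1 - a)], so that the gradient of the
    first sum is the vector of densities [outflow x i / c i]. *)
Definition lyapunov x : R :=
  \sum_(i in S) potential (x i 0) / c i 0 + leak_weight * \sum_k h k * x k 0.

Lemma inner_ge0 x i : simplex x -> 0 <= x i 0 + inner_incr x i.
Proof.
move=> xs; have -> : x i 0 + inner_incr x i =
    x i 0 ^+ 2 + \sum_(k in S) C k i * outflow x k.
  by rewrite /inner_incr /outflow; ring.
by rewrite addr_ge0 ?sqr_ge0 ?inflow_ge0.
Qed.

(** Exact third-order expansion for the increment [d], which completes a square
    because the second derivative of [potential] is at most 1, and the Lipschitz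
    constant 1 for the increment [p]. *)
Lemma potential_step (a d p : R) : 0 <= a + d -> 0 <= p -> a + d + p <= 1 ->
  potential (a + d + p) <= potential a
   + ((a * (1 - a) + d) ^+ 2 - (a * (1 - a)) ^+ 2) / 2 - (a + d / 3) * d ^+ 2 + p.
Proof.
move=> ad0 p0 adp1; set b := a + d in ad0 adp1 *.
have -> : potential a + ((a * (1 - a) + d) ^+ 2 - (a * (1 - a)) ^+ 2) / 2
     - (a + d / 3) * d ^+ 2 = potential b.
  by rewrite /potential /b; field.
rewrite /potential -subr_ge0.
have -> : b ^+ 2 / 2 - b ^+ 3 / 3 + p - ((b + p) ^+ 2 / 2 - (b + p) ^+ 3 / 3) =
  p * ((1 - (b + p)) + p / 2 + b ^+ 2 + b * p + p ^+ 2 / 3) by field.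
have b2 := sqr_ge0 b; have p2 := sqr_ge0 p; have bp := mulr_ge0 ad0 p0.
by rewrite mulr_ge0 //; lra.
Qed.

(** The second-order term of the increment of [potential] combines with the
    first-order one into a difference of squares, which the contraction of the
    reversed chain makes nonpositive; the cubic remainder is the dissipation.
    The mass that enters from outside the recurrent class is paid for by the
    decrease of the weighted transient mass. *)
Lemma lyapunov_dissipation x : simplex x ->
  lyapunov (DF_map C x)
   + \sum_(i in S) (x i 0 + inner_incr x i / 3) * inner_incr x i ^+ 2 / c i 0
   + leak x <= lyapunov x.
Proof.
move=> xs; rewrite /lyapunov transient_mass_decrease.
pose p i := \sum_(k | k \notin S) C k i * outflow x k.
have step : \sum_(i in S) potential (DF_map C x i 0) / c i 0 <=
    \sum_(i in S) (potential (x i 0) / c i 0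
      + 2^-1 * ((outflow x i + inner_incr x i) ^+ 2 / c i 0)
      - 2^-1 * (outflow x i ^+ 2 / c i 0)
      - (x i 0 + inner_incr x i / 3) * inner_incr x i ^+ 2 / c i 0
      + (c i 0)^-1 * leak x).
  apply: ler_sum => i iS; have ci := centrality_gt0 iS.
  have Fi1 : DF_map C x i 0 <= 1 by apply: simplex_le1; apply: simplex_DF.
  rewrite DF_split -/(p i) in Fi1 *.
  have p0 : 0 <= p i by exact: inflow_ge0.
  have pl : p i <= leak x by exact: inflow_le.
  have := potential_step (inner_ge0 i xs) p0 Fi1.
  set y := potential (_ + p i) => st.
  rewrite ler_pdivrMr //.
  apply: le_trans st _; rewrite -/(outflow x i) -subr_ge0.
  set rhs := (X in X - _).
  have -> : rhs = potential (x i 0) + (outflow x i + inner_incr x i) ^+ 2 / 2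
       - outflow x i ^+ 2 / 2
       - (x i 0 + inner_incr x i / 3) * inner_incr x i ^+ 2 + leak x.
    by rewrite /rhs; field; apply: lt0r_neq0.
  lra.
have := reversed_chain_contraction (outflow x).
rewrite (eq_bigr (fun i => (outflow x i + inner_incr x i) ^+ 2 / c i 0)); last first.
  by move=> i iS; congr (_ ^+ 2 / _); rewrite /inner_incr; ring.
move: step; rewrite !big_split /= !sumrN -!mulr_sumr -mulr_suml /leak_weight.
set Pn := \sum_(i in S) potential (DF_map _ _ _ _) / _.
set P := \sum_(i in S) potential _ / _.
set s1 := \sum_(i in S) _ ^+ 2 / _.
set s2 := \sum_(i in S) outflow _ _ ^+ 2 / _.
set s3 := \sum_(i in S) _ * _ ^+ 2 / _.
set s4 := \sum_(i in S) _^-1.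
set s5 := \sum_k _ * _ => st cn.
have -> : (1 + s4) * (s5 - leak x) = (1 + s4) * s5 - leak x - s4 * leak x by ring.
lra.
Qed.

End Lyapunov.

(** * Elementary estimates *)

Section RealLemmas.
Variable R : realType.

Lemma geometric_bound (u : nat -> R) (rho : R) (T : nat) : 0 < rho ->
    (forall t, (T <= t)%N -> u t.+1 <= rho * u t) ->
  exists2 M, 0 < M & forall t, u t <= M * rho ^+ t.
Proof.
move=> rho0 dec; pose M := 1 + \sum_(s < T.+1) `|u s| / rho ^+ s.
have ge0 s : 0 <= `|u s| / rho ^+ s by rewrite divr_ge0 ?exprn_ge0 // ltW.
have M0 : 0 < M by apply: ltr_pwDl => //; apply: sumr_ge0.
exists M => // t; have small s : (s <= T)%N -> u s <= M * rho ^+ s.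
  move=> sT; apply: le_trans (ler_norm _) _.
  rewrite -ler_pdivrMr ?exprn_gt0 // /M (bigD1 (Ordinal (sT : (s < T.+1)%N))) //=.
  by rewrite addrCA lerDl addr_ge0 // sumr_ge0.
have [tT|/ltnW Tt] := leqP t T; first exact: small.
rewrite -(subnK Tt); elim: (t - T)%N => [|k IH]; first exact: small.
rewrite addSn exprS mulrCA; apply: le_trans (dec _ (leq_addl _ _)) _.
by rewrite ler_pM2l.
Qed.

Lemma geometric_tail (u M rho : R) (T t : nat) : 0 < rho -> rho <= 1 ->
    0 <= M -> u <= 1 -> ((T <= t)%N -> u <= M * rho ^+ t) ->
  u <= (M + rho ^- T) * rho ^+ t.
Proof.
move=> rho0 rho1 M0 u1 tail; rewrite mulrDl; have [Tt|/ltnW tT] := leqP T t.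
  apply: ler_wpDr (tail Tt).
  by rewrite mulr_ge0 ?invr_ge0 ?exprn_ge0 // ltW.
apply: ler_wpDl; first by rewrite mulr_ge0 ?exprn_ge0 // ltW.
apply: le_trans u1 _; rewrite ler_pdivlMl ?exprn_gt0 // mulr1.
by apply: ler_wiXn2l => //; exact: ltW.
Qed.

Lemma uniform_positive (I : finType) (P : I -> R -> Prop) :
    (forall i a b, P i a -> 0 < b <= a -> P i b) ->
    (forall i, exists2 a, 0 < a & P i a) ->
  exists2 a, 0 < a & forall i, P i a.
Proof.
move=> anti ex.
have /fin_all_exists[f fP] (i : I) : exists a, 0 < a /\ P i a.
  by have [a a0 Pa] := ex i; exists a.
have Ff s : 0 < \big[Num.min/1]_(i <- s) f i.
  elim/big_ind: _ => // [a b a0 b0|i _]; last by have [] := fP i.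
  by rewrite lt_min a0.
exists (\big[Num.min/1]_i f i) => // i.
by apply: anti (fP i).2 _; rewrite Ff (bigD1 i) //= ge_min lexx.
Qed.

Lemma uniform_bound (I : finType) (P : I -> R -> Prop) :
    (forall i a b, P i a -> a <= b -> P i b) ->
    (forall i, exists2 a, 0 <= a & P i a) ->
  exists2 a, 0 < a & forall i, P i a.
Proof.
move=> mono ex.
have /fin_all_exists[f fP] (i : I) : exists a, 0 <= a /\ P i a.
  by have [a a0 Pa] := ex i; exists a.
exists (1 + \sum_i f i) => [|i].
  by apply: ltr_pwDl => //; apply: sumr_ge0 => i _; have [] := fP i.
apply: mono (fP i).2 _; rewrite (bigD1 i) //= addrCA lerDl addr_ge0 //.
by apply: sumr_ge0 => j _; have [] := fP j.
Qed.

End RealLemmas.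

(** * Repulsion from the autocratic configurations *)

Section Persistence.
Variables (R : realType) (n : nat) (C : 'M[R]_n).
Hypothesis Cstoch : row_stochastic C.
Let S := globally_reachable_nodes (digraph C).
Variable x0 : 'cV[R]_n.
Hypotheses (x0s : simplex x0) (x0n : ~ autocratic x0).
Let x := self_weights C x0.

Lemma support_spreads t a b : 0 < x t a 0 -> connect (digraph C) a b ->
  exists u, 0 < x (t + u)%N b 0.
Proof.
move=> xa /connectP[s ps ->]; exists (size s).
elim: s t a xa ps => [|d s IH] t a xa /=; first by rewrite addn0.
move=> /andP[Cad ps]; rewrite -addSnnS; apply: IH ps.
have xs := orbit_simplex Cstoch x0s t.
have xl := (autocraticP xs).1 (@orbit_nonautocratic _ _ _ Cstoch _ x0s x0n t).
rewrite /x /self_weights iterS -/(self_weights C x0 t) DF_mapE.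
rewrite (bigD1 a) //= -addrA ltr_pwDl //.
  by rewrite !mulr_gt0 ?subr_gt0.
by rewrite addr_ge0 ?sqr_ge0 ?inflow_ge0.
Qed.

(** No mass flows out of the recurrent class. *)
Lemma transient_mass_nonincreasing y : simplex y ->
  \sum_(k | k \notin S) DF_map C y k 0 <= \sum_(k | k \notin S) y k 0.
Proof.
move=> ys; rewrite -subr_le0 -sumrB.
under eq_bigr do rewrite DF_incr (bigID (mem S)) /=.
rewrite sumrB subr_le0 (eq_bigr (fun k =>
  \sum_(j | j \notin S) C j k * outflow y j)) => [|k kS]; last first.
  by rewrite big1 ?add0r // => j jS; rewrite sink_closed ?mul0r.
rewrite exchange_big /=; apply: ler_sum => j jS.
rewrite -mulr_suml ler_piMl ?outflow_ge0 // -(stoch_sum1 Cstoch j).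
by rewrite [leRHS](bigID (mem S)) /= lerDr sumr_ge0 // => k _; rewrite stoch_ge0.
Qed.

(** Away from an autocratic configuration every node of the support feeds its
    out-neighbours, so the recurrent class eventually receives some mass, and
    it never loses any. *)
Lemma transient_mass_bounded i0 : i0 \in S ->
  exists T s, 0 < s /\
    forall t, (T <= t)%N -> \sum_(k | k \notin S) x t k 0 <= 1 - s.
Proof.
move=> i0S; have [a xa] : exists a, 0 < x0 a 0.
  apply: contrapT => /forallNP none.
  have := x0s.2; rewrite big1 => [/esym/eqP|i _]; first by rewrite oner_eq0.
  by apply/eqP; rewrite eq_le (x0s.1 i) andbT leNgt; apply/negP/none.
have [T xT] := support_spreads (t := 0) xa (sink_reach a i0S).
rewrite add0n in xT; exists T, (x T i0 0); split=> // t Tt.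
rewrite -(subnK Tt); elim: (t - T)%N => [|k IH].
  rewrite add0n -(simplex_others i0 (orbit_simplex Cstoch x0s T)).
  rewrite big_mkcond [leRHS]big_mkcond; apply: ler_sum => k _.
  have [->|_] := eqVneq k i0; first by rewrite i0S.
  have := (orbit_simplex Cstoch x0s T).1 k.
  by case: ifP.
apply: le_trans IH; exact: transient_mass_nonincreasing (orbit_simplex _ _ _).
Qed.

(** Mass at distance [d = 1 - x i] from [e_i] is weighted by the hitting times
    of [i]; the flow identity makes this weight grow near [e_i] exactly when the
    return time [1 / c i] exceeds 2, and one step of the map cannot bring a point
    at distance [d] closer than order [d ^ 2]. *)
Lemma autocrat_repels c i : dominant_left_eigenvector C c -> i \in S ->
  c i 0 < 2^-1 -> exists2 e, 0 < e & forall t, x t i 0 <= 1 - e.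
Proof.
move=> cdom iS c_half; have [ci [w [w0 wi w1 flow]]] := hitting_time_flow Cstoch cdom iS.
have n0 : 0 < n%:R :> R by rewrite ltr0n; apply: leq_ltn_trans (ltn_ord i).
pose ka := (c i 0)^-1 - 1.
have ka1 : 1 < ka.
  have : 2 < (c i 0)^-1 by rewrite -[ltLHS]invrK ltf_pV2 ?posrE ?invr_gt0.
  by rewrite /ka; lra.
pose d0 : R := 1 - ka^-1.
have d0_gt0 : 0 < d0 by rewrite subr_gt0 invf_lt1 //; lra.
pose L (y : 'cV[R]_n) := \sum_k w k * y k 0.
have L_ge y : simplex y -> 1 - y i 0 <= L y.
  move=> ys; rewrite -(simplex_others i ys) /L [leRHS](bigD1 i) //= wi mul0r add0r.
  by apply: ler_sum => k ki; rewrite ler_peMl ?w1 // ys.1.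
pose B := 1 + \sum_k w k.
have B0 : 0 < B by apply: ltr_pwDl => //; apply: sumr_ge0.
have L_le y : simplex y -> L y <= B * (1 - y i 0).
  move=> ys; rewrite -(simplex_others i ys) /L [leLHS](bigD1 i) //= wi mul0r add0r.
  rewrite mulr_sumr; apply: ler_sum => k ki; apply: ler_wpM2r; first exact: ys.1.
  by rewrite /B (bigD1 k) //= addrCA lerDl addr_ge0 // sumr_ge0.
pose l := Num.min (L x0) (d0 ^+ 2 / n%:R).
have l0 : 0 < l.
  rewrite lt_min divr_gt0 ?exprn_gt0 // andbT.
  apply: lt_le_trans (L_ge _ x0s); rewrite subr_gt0.
  exact: (autocraticP x0s).1.
have Lx t : l <= L (x t).
  elim: t => [|t IH]; first by rewrite ge_min lexx.
  have ys := orbit_simplex Cstoch x0s t; rewrite -/(x t) in ys.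
  have Fs := simplex_DF Cstoch ys.
  rewrite /x /self_weights iterS -/(self_weights C x0 t) -/(x t).
  have [near|far] := leP (1 - x t i 0) d0.
    apply: le_trans IH _; rewrite -subr_ge0 /L -sumrB.
    rewrite (eq_bigr (fun j => w j * (\sum_k C k j * outflow (x t) k
        - outflow (x t) j))) => [|j _]; last by rewrite -mulrBr DF_incr.
    rewrite flow (bigD1 i) //= opprD addrA.
    have others : \sum_(k | k != i) outflow (x t) k <= 1 - x t i 0.
      by rewrite -(simplex_others i ys); apply: ler_sum => k _; apply: outflow_le.
    have -> : outflow (x t) i / c i 0 - outflow (x t) i
        = ka * x t i 0 * (1 - x t i 0) by rewrite /ka /outflow; ring.
    have ge1 : 1 <= ka * x t i 0.
      rewrite -ler_pdivrMl ?mulr1; last lra.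
      by move: near; rewrite /d0; lra.
    have := ler_wpM2r (_ : 0 <= 1 - x t i 0) ge1; rewrite subr_ge0 simplex_le1 //.
    move=> /(_ isT); lra.
  rewrite ge_min; apply/orP; right.
  apply: le_trans (L_ge _ Fs); rewrite -(simplex_others i Fs).
  (* the quadratic mean of the other entries is at least their mean *)
  pose e := d0 / n%:R.
  apply: (@le_trans _ _ (\sum_(k | k != i) (2 * e * x t k 0 - e ^+ 2))).
    rewrite sumrB -mulr_sumr simplex_others // sumr_const.
    have cn : e ^+ 2 *+ #|[pred k | k != i]| <= e ^+ 2 *+ n.
      rewrite -[leLHS]mulr_natr -[leRHS]mulr_natr ler_wpM2l ?sqr_ge0 // ler_nat.
      by apply: leq_trans (max_card _) _; rewrite card_ord.
    apply: (@le_trans _ _ (2 * e * d0 - e ^+ 2 *+ n)).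
      rewrite -mulr_natr /e le_eqVlt; apply/orP; left; apply/eqP.
      by field; rewrite gt_eqF.
    apply: lerB => //; rewrite ler_wpM2l ?(ltW far) //.
    by rewrite mulr_ge0 // divr_ge0 // ltW.
  apply: ler_sum => k _; apply: le_trans (DF_ge_sqr Cstoch k ys).
  rewrite -subr_ge0; have -> : x t k 0 ^+ 2 - (2 * e * x t k 0 - e ^+ 2) =
    (x t k 0 - e) ^+ 2 by ring.
  exact: sqr_ge0.
exists (l / B); first exact: divr_gt0.
move=> t; rewrite lerBrDr -lerBrDl ler_pdivrMr // mulrC.
by apply: le_trans (Lx t) (L_le _ _); apply: orbit_simplex.
Qed.

End Persistence.

(** * Equilibria *)

Section Equilibria.
Variables (R : realType) (n : nat) (C : 'M[R]_n).
Hypothesis Cstoch : row_stochastic C.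
Let S := globally_reachable_nodes (digraph C).
Variable i0 : 'I_n.
Hypothesis i0S : i0 \in S.
Variable c : 'cV[R]_n.
Hypothesis cdom : dominant_left_eigenvector C c.
Implicit Types x y : 'cV[R]_n.

Definition defect x : R := \sum_k `|DF_map C x k 0 - x k 0|.

(** Up to the defect, the outflow vector is a left fixed vector of [C], hence a
    multiple of [c]. *)
Lemma outflow_almost_central : exists2 K, 0 < K & forall x i, simplex x ->
  `|outflow x i - c i 0 * \sum_k outflow x k| <= K * defect x.
Proof.
have pairing (w : 'I_n -> R) x : (forall k, 0 <= w k) ->
    `|\sum_j w j * (\sum_k C k j * outflow x k - outflow x j)|
      <= (\sum_k w k) * defect x.
  move=> w0; apply: le_trans (ler_norm_sum _ _ _) _.
  rewrite mulr_sumr; apply: ler_sum => k _; rewrite normrM -DF_incr.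
  apply: ler_pM => //; rewrite ger0_norm // (bigD1 k) //= lerDl.
  exact: sumr_ge0.
have [h [h0 _ _ hflow]] := sink_hitting_flow Cstoch i0S.
have [|i|K K0 KP] := @uniform_bound R 'I_n (fun i K => forall x, simplex x ->
  `|outflow x i - c i 0 * \sum_k outflow x k| <= K * defect x).
- move=> i a b aP ab x xs; apply: le_trans (aP x xs) _.
  by rewrite ler_wpM2r // sumr_ge0.
- have [iS|iS] := boolP (i \in S).
    have [ci [w [w0 _ _ flow]]] := hitting_time_flow Cstoch cdom iS.
    exists (c i 0 * \sum_k w k) => [|x xs].
      by rewrite mulr_ge0 ?sumr_ge0 // ltW.
    have := pairing w x w0; rewrite flow => le.
    have -> : outflow x i - c i 0 * \sum_k outflow x k =
      c i 0 * (outflow x i / c i 0 - \sum_k outflow x k).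
      by field; rewrite gt_eqF.
    by rewrite normrM gtr0_norm // -mulrA ler_pM2l.
  exists (\sum_k h k) => [|x xs]; first exact: sumr_ge0.
  rewrite (dominant_off_sink Cstoch i0S cdom iS) mul0r subr0.
  apply: le_trans (pairing h x h0); rewrite hflow normrN (bigD1 i) //=.
  rewrite !ger0_norm ?outflow_ge0 ?addr_ge0 ?sumr_ge0 ?outflow_ge0 ?lerDl //.
    by rewrite sumr_ge0 // => k _; rewrite outflow_ge0.
  by move=> k _; rewrite outflow_ge0.
by exists K => // x i; apply: KP.
Qed.

Lemma fixed_outflow x i : simplex x -> DF_map C x = x ->
  outflow x i = c i 0 * \sum_k outflow x k.
Proof.
move=> xs Fx; have [K _ /(_ x i xs)] := outflow_almost_central.
have -> : defect x = 0 by apply: big1 => k _; rewrite Fx subrr normr0.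
by rewrite mulr0 normr_le0 subr_eq0 => /eqP.
Qed.

Section NonAutocratic.
Variable x : 'cV[R]_n.
Hypotheses (xs : simplex x) (xn : ~ autocratic x) (Fx : DF_map C x = x).

Lemma fixed_lt1 i : x i 0 < 1. Proof. exact: (autocraticP xs).1. Qed.

Lemma fixed_total_outflow_gt0 : 0 < \sum_k outflow x k.
Proof.
rewrite lt_def sumr_ge0 ?andbT => [|k _]; last exact: outflow_ge0.
apply/negP => /eqP z0.
have zero k : x k 0 = 0.
  have : outflow x k = 0.
    by apply: (psumr_eq0P _ z0) => // j _; apply: outflow_ge0.
  move/eqP; rewrite mulf_eq0 subr_eq0 [1 == _]eq_sym.
  by rewrite (lt_eqF (fixed_lt1 k)) orbF => /eqP.
by have := xs.2; rewrite big1 // => /esym/eqP; rewrite oner_eq0.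
Qed.

Lemma fixed_sink_gt0 i : i \in S -> 0 < x i 0.
Proof.
move=> iS; rewrite lt_def xs.1 andbT; apply/negP => /eqP xi.
have := fixed_outflow i xs Fx; rewrite /outflow xi mul0r => /esym/eqP.
apply/negP/lt0r_neq0/mulr_gt0; last exact: fixed_total_outflow_gt0.
exact: (centrality_gt0 Cstoch cdom iS).
Qed.

Lemma fixed_off_sink i : i \notin S -> x i 0 = 0.
Proof.
move=> iS; have := fixed_outflow i xs Fx.
rewrite (dominant_off_sink Cstoch i0S cdom iS) mul0r => /eqP.
by rewrite mulf_eq0 subr_eq0 [1 == _]eq_sym (lt_eqF (fixed_lt1 i)) orbF => /eqP.
Qed.

Hypothesis S3 : (2 < #|S|)%N.

(** A third node of the recurrent class holds some of the mass.  This is what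
    fails when the class has only two nodes, where the equilibria form a
    segment. *)
Lemma fixed_pair_lt1 i j : i != j -> x i 0 + x j 0 < 1.
Proof.
move=> ij; have [k kS] : exists2 k, k \in S & k \notin [set i; j]%SET.
  apply/subsetPn; apply: contraL S3 => /subset_leq_card.
  by rewrite -leqNgt cards2 => /leq_trans; apply; case: (i != j).
rewrite !inE negb_or => /andP[ki kj].
have := xs.2; rewrite (bigD1 i) //= (bigD1 j) 1?eq_sym //= (bigD1 k) ?ki //=.
set rest := \sum_(l | _) _; have xk := fixed_sink_gt0 kS.
have : 0 <= rest by apply: sumr_ge0 => l _; exact: xs.1.
lra.
Qed.

(** [a * (1 - a)] orders any two weights of sum less than 1 as [a] does. *)
Lemma fixed_ranking i j : i \in S -> (x j 0 < x i 0) = (c j 0 < c i 0).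
Proof.
move=> iS; have [->|ij] := eqVneq i j; first by rewrite !ltxx.
rewrite -[RHS](ltr_pM2r fixed_total_outflow_gt0) -!fixed_outflow //.
rewrite -[RHS]subr_gt0.
have -> : outflow x i - outflow x j = (x i 0 - x j 0) * (1 - (x i 0 + x j 0)).
  by rewrite /outflow; ring.
by rewrite pmulr_lgt0 subr_gt0 // fixed_pair_lt1.
Qed.

(** The outflow of [i] balances the outflow of the others only when [i] is less
    central than all of them together. *)
Lemma fixed_centrality_lt_half i : c i 0 < 2^-1.
Proof.
have z0 := fixed_total_outflow_gt0; rewrite -(ltr_pM2r z0) -fixed_outflow //.
rewrite (bigD1 i) //=.
suff : outflow x i < \sum_(k | k != i) outflow x k by lra.
have [j jS ji] : exists2 j, j \in S & j != i.
  have [j /setD1P[ji jS]] : exists j, j \in (S :\ i)%SET.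
    by apply/card_gt0P; have := cardsD1 i S; have := S3; case: (i \in S) => /=; lia.
  by exists j.
rewrite {1}/outflow -(simplex_others i xs) mulr_sumr.
rewrite (bigD1 j) //= [ltRHS](bigD1 j) //=.
have le k : k != i -> x i 0 * x k 0 <= outflow x k.
  move=> ki; rewrite /outflow mulrC ler_wpM2l ?xs.1 //.
  by have := fixed_pair_lt1 ki; lra.
apply: ltr_leD; last by apply: ler_sum => k /andP[ki _]; apply: le.
rewrite /outflow mulrC ltr_pM2l ?fixed_sink_gt0 //.
by have := fixed_pair_lt1 ji; lra.
Qed.

End NonAutocratic.

Hypothesis S3 : (2 < #|S|)%N.

Definition top_node := [arg max_(i > i0) c i 0]%O.

Lemma top_node_max i : c i 0 <= c top_node 0.
Proof. by rewrite /top_node; case: arg_maxP => // k _; apply. Qed.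

Lemma top_node_sink : top_node \in S.
Proof.
apply: contraT => pS; have := top_node_max i0.
by rewrite (dominant_off_sink Cstoch i0S cdom pS) leNgt (centrality_gt0 Cstoch cdom).
Qed.

Lemma fixed_lt_half x i : simplex x -> ~ autocratic x -> DF_map C x = x ->
  i != top_node -> x i 0 < 2^-1.
Proof.
move=> xs xn Fx ip; have := fixed_pair_lt1 xs xn Fx S3 ip.
suff : x i 0 <= x top_node 0 by lra.
have [iS|iS] := boolP (i \in S); last by rewrite (fixed_off_sink xs) // xs.1.
by rewrite leNgt fixed_ranking // -leNgt top_node_max.
Qed.

(** Compare two equilibria through the share [x j / (1 - x p)] that a node [j]
    takes of what the most central node [p] leaves.  When [p] leaves more,
    the ratio [outflow x j / outflow x p] can only stay equal to [c j / c p] if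
    the share of every [j] decreases, although the shares sum to 1. *)
Lemma fixed_top_le x y : simplex x -> ~ autocratic x -> DF_map C x = x ->
  simplex y -> ~ autocratic y -> DF_map C y = y ->
  x top_node 0 <= y top_node 0.
Proof.
set p := top_node.
move=> xs xn Fx ys yn Fy; rewrite leNgt; apply/negP => lt_yx.
pose a := 1 - x p 0; pose b := 1 - y p 0.
have a0 : 0 < a by rewrite subr_gt0 fixed_lt1.
have ab : a < b by rewrite /a /b; lra.
have pS : p \in S := top_node_sink.
have b1 : b < 1 by have := fixed_sink_gt0 ys yn Fy pS; rewrite /b; lra.
have [j [jS jp share]] : exists j, [/\ j \in S, j != p & x j 0 * b <= y j 0 * a].
  apply: contrapT => none.
  have lt j : j \in S -> j != p -> y j 0 * a < x j 0 * b.
    by move=> jS jp; rewrite ltNge; apply/negP => ge; apply: none; exists j.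
  have le j : j != p -> y j 0 * a <= x j 0 * b.
    move=> jp; have [jS|jS] := boolP (j \in S); first by rewrite ltW ?lt.
    by rewrite (fixed_off_sink ys yn Fy jS) (fixed_off_sink xs xn Fx jS) !mul0r.
  have [j /setD1P[jp jS]] : exists j, j \in (S :\ p)%SET.
    by apply/card_gt0P; have := cardsD1 p S; have := S3; rewrite pS /=; lia.
  suff : \sum_(k | k != p) y k 0 * a < \sum_(k | k != p) x k 0 * b.
    by rewrite -!mulr_suml !simplex_others // -/a -/b mulrC ltxx.
  rewrite (bigD1 j) //= [ltRHS](bigD1 j) //= ltr_leD ?lt //.
  by apply: ler_sum => k /andP[kp _]; apply: le.
have xj0 : 0 < x j 0 := fixed_sink_gt0 xs xn Fx jS.
have yj2 : y j 0 < 2^-1 := fixed_lt_half ys yn Fy jp.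
have xj_lt : x j 0 < a by have := fixed_pair_lt1 xs xn Fx S3 jp; rewrite /a; lra.
have cross : outflow x j * outflow y p = outflow y j * outflow x p.
  rewrite (fixed_outflow j xs Fx) (fixed_outflow p ys Fy).
  rewrite (fixed_outflow j ys Fy) (fixed_outflow p xs Fx); ring.
pose q := x j 0 / a.
have q0 : 0 < q by rewrite divr_gt0.
have q1 : q < 1 by rewrite ltr_pdivrMr ?mul1r.
have xjE : x j 0 = q * a by rewrite divfK ?gt_eqF.
have qb : q * b <= y j 0.
  by rewrite -(ler_pM2r a0) mulrAC -xjE.
have incr : q * b * (1 - q * b) <= outflow y j.
  rewrite -subr_ge0 /outflow.
  have -> : y j 0 * (1 - y j 0) - q * b * (1 - q * b) =
    (y j 0 - q * b) * (1 - y j 0 - q * b) by ring.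
  by apply: mulr_ge0; lra.
have ox : outflow x p = (1 - a) * a by rewrite /outflow /a; ring.
have oy : outflow y p = (1 - b) * b by rewrite /outflow /b; ring.
have ox0 : 0 < outflow x p by rewrite ox mulr_gt0 //; lra.
have := ler_wpM2r (ltW ox0) incr; rewrite -cross ox oy /outflow xjE leNgt.
move=> /negP; apply; rewrite -subr_gt0.
have -> : q * b * (1 - q * b) * ((1 - a) * a) - q * a * (1 - q * a) * ((1 - b) * b)
  = q * a * b * ((b - a) * (1 - q)) by ring.
have b0 := lt_trans a0 ab.
apply: mulr_gt0; first by apply: mulr_gt0 b0; apply: mulr_gt0.
by apply: mulr_gt0; rewrite subr_gt0.
Qed.

Lemma fixed_unique x y : simplex x -> ~ autocratic x -> DF_map C x = x ->
  simplex y -> ~ autocratic y -> DF_map C y = y -> x = y.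
Proof.
move=> xs xn Fx ys yn Fy; set p := top_node.
have xyp : x p 0 = y p 0.
  by apply/eqP; rewrite eq_le !fixed_top_le.
have total : \sum_k outflow x k = \sum_k outflow y k.
  have cp : c p 0 != 0 by rewrite lt0r_neq0 // (centrality_gt0 Cstoch cdom top_node_sink).
  apply: (mulfI cp); rewrite -!fixed_outflow //.
  by rewrite /outflow xyp.
apply/colP => j; have [->//|jp] := eqVneq j p.
have : outflow x j = outflow y j by rewrite !fixed_outflow // total.
have x2 := fixed_lt_half xs xn Fx jp; have y2 := fixed_lt_half ys yn Fy jp.
move/eqP; rewrite -subr_eq0 /outflow.
have -> : x j 0 * (1 - x j 0) - y j 0 * (1 - y j 0) =
  (x j 0 - y j 0) * (1 - x j 0 - y j 0) by ring.
rewrite mulf_eq0 subr_eq0 => /orP[/eqP //|/eqP]; lra.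
Qed.

End Equilibria.

(** * Compactness *)

Section Compactness.
Variables (R : realType) (n : nat).
Implicit Types (x : 'cV[R]_n) (Z : set 'cV[R]_n).

Lemma trmx_continuous m k : continuous (@trmx R m k).
Proof.
move=> v A [P vP PA]; exists (fun i j => P j i) => [i j|w wP].
  by have := vP j i; rewrite mxE.
by apply: PA => i j; rewrite mxE.
Qed.

Lemma unit_box_compact : compact [set x : 'cV[R]_n | forall i, 0 <= x i 0 <= 1].
Proof.
have -> : [set x : 'cV[R]_n | forall i, 0 <= x i 0 <= 1] =
    trmx @` [set v : 'rV[R]_n | forall i, `[0, 1]%classic (v 0 i)].
  apply/seteqP; split=> [x xB|_ [v vB <-] i].
    exists x^T; last by rewrite trmxK.
    by move=> i; rewrite mxE /= in_itv /= xB.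
  by rewrite mxE; have := vB i; rewrite /= in_itv.
apply: continuous_compact.
  by apply: continuous_subspaceT; exact: trmx_continuous.
apply: (@rV_compact R n (fun=> `[0, 1]%classic)) => i.
exact: segment_compact.
Qed.

Lemma sum_continuous (T : topologicalType) (f : 'I_n -> T -> R) :
  (forall i, continuous (f i)) -> continuous (fun y => \sum_i f i y).
Proof.
move=> fc; apply: continuous_big => [|i _]; last exact: fc.
exact: add_continuous.
Qed.

Lemma coord0_continuous i : continuous (fun x : 'cV[R]_n => x i 0).
Proof. exact: coord_continuous. Qed.

(** The regions in which orbits are confined (for [e = 0]) and the part of them
    that stays away from a given limit. *)
Lemma slab_closed (b : 'I_n -> R) (e q : R) (j : 'I_n) :
  closed [set x : 'cV[R]_n | [/\ simplex x, forall i, x i 0 <= b i & e <= `|x j 0 - q|]].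
Proof.
have cl (f : 'cV[R]_n -> R) (D : set R) : continuous f -> closed D ->
    closed (f @^-1` D) by move=> /continuous_closedP; apply.
rewrite (_ : mkset _ =
    (\bigcap_(i in [set: 'I_n]) [set x : 'cV[R]_n | 0 <= x i 0]
       `&` [set x : 'cV[R]_n | \sum_i x i 0 = 1])
    `&` (\bigcap_(i in [set: 'I_n]) [set x : 'cV[R]_n | x i 0 <= b i])
    `&` [set x : 'cV[R]_n | e <= `|x j 0 - q|]).
  apply: closedI; first apply: closedI; first apply: closedI.
  - apply: closed_bigI => i _.
    exact: (cl (fun x => x i 0) _ (@coord0_continuous i) (@closed_ge R 0)).
  - apply: (cl (fun x => \sum_i x i 0) _ _ (@closed_eq R 1)).
    by apply: sum_continuous => i; exact: coord0_continuous.
  - apply: closed_bigI => i _.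
    exact: (cl (fun x => x i 0) _ (@coord0_continuous i) (@closed_le R (b i))).
  apply: (cl (fun x => `|x j 0 - q|) _ _ (@closed_ge R e)) => x.
  apply: (@continuous_comp _ _ _
    (fun x : 'cV[R]_n => x j 0 - q) (fun y : R => `|y|)); last exact: norm_continuous.
  apply: (@continuousB _ _ _ (fun y : 'cV[R]_n => y j 0) (fun=> q)).
    exact: coord0_continuous.
  exact: cst_continuous.
apply/seteqP; split=> [x [[x0 x1] xb xq]|x [[[x0 x1] xb] xq]].
  by split=> //; split=> [|i _]; [split=> [i _|//]; exact: x0|exact: xb].
split=> // [|i]; last exact: xb.
by split=> // i; exact: x0.
Qed.

Variable C : 'M[R]_n.

Lemma DF_continuous i : continuous (fun x : 'cV[R]_n => DF_map C x i 0).
Proof.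
rewrite (_ : (fun x => _) = (fun x : 'cV[R]_n =>
    \sum_k (C k i * (x k 0 * (1 - x k 0))) + x i 0 * x i 0)); last first.
  by apply/funext => x; rewrite DF_mapE.
have mulc (f g : 'cV[R]_n -> R) :
    continuous f -> continuous g -> continuous (fun y => f y * g y).
  by move=> fc gc y; apply: (@continuousM _ _ f g y); [exact: fc|exact: gc].
have subc (f g : 'cV[R]_n -> R) :
    continuous f -> continuous g -> continuous (fun y => f y - g y).
  by move=> fc gc y; apply: (@continuousB _ _ _ f g y); [exact: fc|exact: gc].
have cc := @coord0_continuous.
have inflow_cont : continuous
    (fun y : 'cV[R]_n => \sum_k C k i * (y k 0 * (1 - y k 0))).
  apply: (sum_continuous
    (f := fun k (y : 'cV[R]_n) => C k i * (y k 0 * (1 - y k 0)))) => k.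
  apply: (mulc (fun=> C k i)); first by move=> y; exact: cst_continuous.
  apply: (mulc (fun y => y k 0)); first exact: cc.
  by apply: (subc (fun=> 1)); [move=> y; exact: cst_continuous|exact: cc].
move=> x; apply: (@continuousD _ _ _
  (fun y : 'cV[R]_n => \sum_k C k i * (y k 0 * (1 - y k 0)))
  (fun y : 'cV[R]_n => y i 0 * y i 0)); first exact: inflow_cont.
by apply: (mulc (fun y => y i 0)); exact: cc.
Qed.

Lemma defect_continuous : continuous (defect C).
Proof.
apply: (sum_continuous
  (f := fun k (x : 'cV[R]_n) => `|DF_map C x k 0 - x k 0|)) => k x.
apply: (@continuous_comp _ _ _ (fun x : 'cV[R]_n => DF_map C x k 0 - x k 0)
  (fun y : R => `|y|)); last exact: norm_continuous.
apply: (@continuousB _ _ _ (fun y : 'cV[R]_n => DF_map C y k 0) (fun y => y k 0)).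
  exact: DF_continuous.
exact: coord0_continuous.
Qed.

(** The defect attains its infimum, here 0, on a compact set. *)
Lemma fixed_point_by_compactness Z : closed Z -> Z `<=` simplex ->
    (forall e, 0 < e -> exists2 x, Z x & defect C x <= e) ->
  exists2 x, Z x & DF_map C x = x.
Proof.
move=> Zcl Zs small; have Zc : compact Z.
  apply: subclosed_compact Zcl unit_box_compact _ => x /Zs xs i.
  by rewrite (xs.1 i) simplex_le1.
have Z0 : Z !=set0 by have [x Zx _] := small 1 ltr01; exists x.
have dc : {within Z, continuous (defect C)}.
  by apply: continuous_subspaceT; exact: defect_continuous.
have [x /set_mem Zx xmin] := compact_EVT_min Z0 Zc dc.
exists x => //; have d0 : defect C x = 0.
  apply/eqP; rewrite eq_le sumr_ge0 // andbT leNgt; apply/negP => pos.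
  have pos2 : 0 < defect C x / 2 by rewrite divr_gt0.
  have [y /mem_set Zy] := small _ pos2.
  by have := xmin y Zy; lra.
apply/colP => i; apply/eqP; rewrite -subr_eq0 -normr_eq0.
by apply/eqP; apply: (psumr_eq0P _ d0).
Qed.

End Compactness.

Lemma nonincreasing_limit (R : realType) (u : nat -> R) :
    (forall t, 0 <= u t) -> (forall t, u t.+1 <= u t) ->
  exists l, [/\ 0 <= l, forall t, l <= u t &
    forall e, 0 < e -> exists T, forall t, (T <= t)%N -> u t <= l + e].
Proof.
move=> u0 dec; have ninc : nonincreasing_seq u by apply/nonincreasing_seqP.
have lb : has_lbound (range u) by exists 0 => _ [t _ <-].
have ucvg : cvgn u by apply: nonincreasing_is_cvgn.
exists (limn u); split.
- by apply: limr_ge => //; apply: nearW.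
- exact: nonincreasing_cvgn_ge.
move=> e e0; have /cvgrPdist_le/(_ e e0)[T _ TP] : u @ \oo --> limn u by [].
by exists T => t Tt; have := TP t Tt; rewrite ler_norml; lra.
Qed.

(** * Vanishing of the steps *)

Section Dissipation.
Variables (R : realType) (n : nat) (C : 'M[R]_n).
Hypothesis Cstoch : row_stochastic C.
Let S := globally_reachable_nodes (digraph C).
Variable i0 : 'I_n.
Hypothesis i0S : i0 \in S.
Variable c : 'cV[R]_n.
Hypothesis cdom : dominant_left_eigenvector C c.
Variable h : 'I_n -> R.
Implicit Types x : 'cV[R]_n.

Hypothesis h_ge0 : forall k, 0 <= h k.
Hypothesis h_flow : forall ze : 'I_n -> R,
  \sum_j h j * (\sum_k C k j * ze k - ze j) = - \sum_(k | k \notin S) ze k.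

Let U := lyapunov C c h.
Definition dissipation x : R :=
  lyapunov C c h x - lyapunov C c h (DF_map C x).

Local Notation D := dissipation.

Lemma centrality_le1 i : c i 0 <= 1.
Proof. exact: simplex_le1 cdom.2. Qed.

Lemma inv_centrality_ge1 i : i \in S -> 1 <= (c i 0)^-1.
Proof. by move=> iS; rewrite invf_ge1 ?(centrality_gt0 Cstoch cdom) ?centrality_le1. Qed.

Lemma dissipation_coef x i : simplex x ->
  2 / 3 * x i 0 <= x i 0 + inner_incr C x i / 3.
Proof. by move=> xs; have := inner_ge0 Cstoch i xs; lra. Qed.

Lemma dissipation_term_ge0 x i : simplex x -> i \in S ->
  0 <= (x i 0 + inner_incr C x i / 3) * inner_incr C x i ^+ 2 / c i 0.
Proof.
move=> xs iS; apply: divr_ge0; last exact/ltW/(centrality_gt0 Cstoch cdom).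
apply: mulr_ge0 (sqr_ge0 _); apply: le_trans (dissipation_coef i xs).
by rewrite mulr_ge0 ?xs.1.
Qed.

Lemma leak_le_dissipation x : simplex x -> leak C x <= D x.
Proof.
move=> xs; have := lyapunov_dissipation Cstoch i0S cdom h_flow xs.
have : 0 <= \sum_(i in S)
    (x i 0 + inner_incr C x i / 3) * inner_incr C x i ^+ 2 / c i 0.
  by apply: sumr_ge0 => i iS; apply: dissipation_term_ge0.
by rewrite /dissipation -/U -/S; lra.
Qed.

Lemma term_le_dissipation x i : simplex x -> i \in S ->
  (x i 0 + inner_incr C x i / 3) * inner_incr C x i ^+ 2 <= D x.
Proof.
move=> xs iS; have := lyapunov_dissipation Cstoch i0S cdom h_flow xs.
have l0 := leak_ge0 C xs.
rewrite (bigD1 i) //=; set T := _ / c i 0; set rest := \sum_(_ | _) _.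
have : 0 <= rest by apply: sumr_ge0 => j /andP[jS _]; apply: dissipation_term_ge0.
suff : (x i 0 + inner_incr C x i / 3) * inner_incr C x i ^+ 2 <= T.
  by rewrite /dissipation -/U; lra.
rewrite /T ler_peMr ?inv_centrality_ge1 //.
apply: mulr_ge0 (sqr_ge0 _); apply: le_trans (dissipation_coef i xs).
by rewrite mulr_ge0 ?xs.1.
Qed.

Lemma dissipation_ge0 x : simplex x -> 0 <= D x.
Proof.
by move=> xs; apply: le_trans (leak_le_dissipation xs); apply: leak_ge0.
Qed.

(** Weights stay nonnegative, so a weight that decreases is at least as large as
    its decrease: the coefficient of the squared increment in the dissipation is
    of the order of the increment itself, even next to the boundary. *)
Lemma cube_le_dissipation x i : simplex x -> i \in S ->
  `|inner_incr C x i| ^+ 3 / 3 <= D x.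
Proof.
move=> xs iS; apply: le_trans (term_le_dissipation xs iS).
rewrite -(real_normK (num_real (inner_incr C x i))).
have -> : `|inner_incr C x i| ^+ 3 / 3 =
  `|inner_incr C x i| / 3 * `|inner_incr C x i| ^+ 2 by ring.
rewrite ler_wpM2r ?sqr_ge0 //.
have := inner_ge0 Cstoch i xs; have := xs.1 i.
by case: (ger0P (inner_incr C x i)); lra.
Qed.

(** Where the weights are bounded below, the dissipation is quadratic in the
    increments; this is the form that yields a rate. *)
Lemma square_le_dissipation x i : simplex x -> i \in S ->
  2 / 3 * x i 0 * inner_incr C x i ^+ 2 <= D x.
Proof.
move=> xs iS; apply: le_trans (term_le_dissipation xs iS).
by rewrite ler_wpM2r ?sqr_ge0 ?dissipation_coef.
Qed.

Lemma step_le_inner x i : simplex x ->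
  `|DF_map C x i 0 - x i 0| <= (i \in S)%:R * `|inner_incr C x i| + leak C x.
Proof.
move=> xs; rewrite DF_split.
set p := \sum_(_ | _) _; have p0 : 0 <= p by exact: inflow_ge0.
have pl : p <= leak C x by exact: inflow_le.
have [iS|iS] := boolP (i \in S).
  rewrite mul1r; have -> : x i 0 + inner_incr C x i + p - x i 0 =
    inner_incr C x i + p by ring.
  by apply: le_trans (ler_normD _ _) _; rewrite lerD2l ger0_norm.
have -> : x i 0 + inner_incr C x i + p - x i 0 = p - outflow x i.
  rewrite /inner_incr big1 => [|k kS]; first by ring.
  by rewrite sink_closed ?mul0r.
have : outflow x i <= leak C x.
  rewrite /leak (bigD1 i) //= lerDl sumr_ge0 // => k _; exact: outflow_ge0.
have := outflow_ge0 i xs; rewrite mul0r add0r ler_norml; lra.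
Qed.

Lemma leak_weight_gt0 : 0 < leak_weight C c.
Proof.
rewrite ltr_pwDl ?sumr_ge0 // => i iS.
by rewrite invr_ge0 ltW // (centrality_gt0 Cstoch cdom).
Qed.

Lemma lyapunov_ge0 x : simplex x -> 0 <= U x.
Proof.
move=> xs; apply: addr_ge0; last first.
  apply: mulr_ge0; first exact/ltW/leak_weight_gt0.
  by apply: sumr_ge0 => k _; rewrite mulr_ge0 ?xs.1.
apply: sumr_ge0 => i iS; apply: divr_ge0; last exact/ltW/(centrality_gt0 Cstoch cdom).
have -> : potential (x i 0) = x i 0 ^+ 2 * (1 / 2 - x i 0 / 3).
  by rewrite /potential; field.
by apply: mulr_ge0 (sqr_ge0 _) _; have := simplex_le1 i xs; lra.
Qed.

Variable x0 : 'cV[R]_n.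
Hypotheses (x0s : simplex x0).
Let x := self_weights C x0.

Let xs t : simplex (x t). Proof. exact: orbit_simplex. Qed.

(** The Lyapunov function decreases to a limit, so its decrements tend to 0. *)
Lemma defect_vanishes e : 0 < e ->
  exists T, forall t, (T <= t)%N -> defect C (x t) <= e.
Proof.
move=> e0; have n0 : 0 <= n%:R :> R by [].
pose a := Num.min 1 (e / (2 * (n%:R + 1))).
have a0 : 0 < a by rewrite lt_min ltr01 divr_gt0 // mulr_gt0 //; lra.
have a1 : a <= 1 by rewrite ge_min lexx.
have ae : n%:R * (a + a) <= e.
  have : a <= e / (2 * (n%:R + 1)) by rewrite ge_min lexx orbT.
  rewrite ler_pdivlMr; last by lra.
  by lra.
have a3 : a ^+ 3 / 3 <= a.
  have : a ^+ 3 <= a by rewrite exprS ler_piMr ?(ltW a0) // exprn_ile1 ?(ltW a0).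
  by lra.
have [||l [_ lU lim]] := @nonincreasing_limit R (fun t => U (x t)).
- by move=> t; apply: lyapunov_ge0.
- by move=> t; have := dissipation_ge0 (xs t); rewrite /dissipation subr_ge0.
have [|T TP] := lim (a ^+ 3 / 3); first by rewrite divr_gt0 ?exprn_gt0.
exists T => t Tt; have Dt : D (x t) <= a ^+ 3 / 3.
  by have := TP t Tt; have := lU t.+1; rewrite /dissipation -/U /x /=; lra.
apply: le_trans ae; rewrite /defect mulr_natl -[X in _ *+ X]card_ord -sumr_const.
apply: ler_sum => i _; apply: le_trans (step_le_inner i (xs t)) _.
apply: lerD; last first.
  by apply: le_trans (leak_le_dissipation (xs t)) _; apply: le_trans Dt _.
have [iS|_] := boolP (i \in S); last by rewrite mul0r ltW.
rewrite mul1r -(@ler_pXn2r _ 3) ?nnegrE ?(ltW a0) //.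
by have := cube_le_dissipation (xs t) iS; lra.
Qed.

Variables (b : 'I_n -> R) (T0 : nat).
Hypothesis trapped : forall t i, (T0 <= t)%N -> x t i 0 <= b i.

Lemma late_small_defect T e : 0 < e ->
  exists t, [/\ (T <= t)%N, (T0 <= t)%N & defect C (x t) <= e].
Proof.
move=> e0; have [T1 T1P] := defect_vanishes e0.
exists (maxn T (maxn T0 T1)).
by split; [| |apply: T1P]; rewrite !leq_max leqnn ?orbT.
Qed.

Lemma trapped_equilibrium :
  exists y, [/\ simplex y, DF_map C y = y & forall i, y i 0 <= b i].
Proof.
have [|e e0|y [ys yb _] Fy] := @fixed_point_by_compactness R n C _
    (@slab_closed R n b 0 0 i0); first by move=> z [].
  have [t [_ Tt d]] := late_small_defect 0 e0.
  by exists (x t) => //; split=> // i; exact: trapped.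
by exists y.
Qed.

Lemma trapped_convergence y :
    (forall z, simplex z -> DF_map C z = z -> (forall i, z i 0 <= b i) -> z = y) ->
  forall j e, 0 < e ->
    exists T, forall t, (T <= t)%N -> `|x t j 0 - y j 0| <= e.
Proof.
move=> uniq j e e0; apply: contrapT => /forallNP far.
have [|e1 e1_gt0|z [zs zb ze] Fz] := @fixed_point_by_compactness R n C _
    (@slab_closed R n b e (y j 0) j); first by move=> z [].
  have [T1 T1P] := defect_vanishes e1_gt0.
  have /existsNP[t /not_implyP[Tt /negP]] := far (maxn T0 T1).
  rewrite -ltNge => lt; move: Tt; rewrite geq_max => /andP[T0t T1t].
  by exists (x t); [split=> // [i|]; [exact: trapped|exact: ltW]|exact: T1P].
by move: ze; rewrite (uniq z) // subrr normr0 leNgt e0.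
Qed.

End Dissipation.

(** * Rate of convergence near an interior equilibrium *)

Section Rate.
Variables (R : realType) (n : nat) (C : 'M[R]_n).
Hypothesis Cstoch : row_stochastic C.
Let S := globally_reachable_nodes (digraph C).
Variable i0 : 'I_n.
Hypothesis i0S : i0 \in S.
Variable c : 'cV[R]_n.
Hypothesis cdom : dominant_left_eigenvector C c.
Hypothesis S3 : (2 < #|S|)%N.
Variable xs : 'cV[R]_n.
Hypotheses (xss : simplex xs) (xsn : ~ autocratic xs) (Fxs : DF_map C xs = xs).
Implicit Types x : 'cV[R]_n.

Let p := top_node i0 c.

Let slope i : R := 1 - 2 * xs i 0.

Lemma slope_gt0 j : j != p -> 0 < slope j.
Proof.
move=> jp; have := fixed_lt_half Cstoch i0S cdom S3 xss xsn Fxs jp.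
by rewrite /slope; lra.
Qed.

(** The linearization of the equilibrium equations at [xs] could only be
    singular if this number vanished; substituting [c = outflow xs / beta] turns
    it into a sum of nonnegative terms, not all 0, whatever the sign of
    [slope p]. *)
Lemma nondegenerate : 0 < c p 0 + slope p * \sum_(j | j != p) c j 0 / slope j.
Proof.
pose be := \sum_k outflow xs k.
have be0 : 0 < be by apply: (fixed_total_outflow_gt0 xss xsn).
rewrite -(pmulr_lgt0 _ be0).
have zE := fixed_outflow Cstoch i0S cdom _ xss Fxs.
have -> : (c p 0 + slope p * \sum_(j | j != p) c j 0 / slope j) * be =
   \sum_(j | j != p) xs j 0 * (1 - (xs p 0 + xs j 0)) / slope j.
  rewrite mulrDl -mulrA -zE {1}/outflow -(simplex_others p xss).
  rewrite mulr_sumr mulr_suml mulr_sumr -big_split /=.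
  apply: eq_bigr => j jp; have sj := slope_gt0 jp.
  have -> : c j 0 / slope j * be = outflow xs j / slope j by rewrite zE mulrAC.
  by rewrite /outflow; move: sj; rewrite /slope => sj; field; apply: lt0r_neq0.
have term j : j != p -> 0 <= xs j 0 * (1 - (xs p 0 + xs j 0)) / slope j.
  move=> jp; apply: divr_ge0; last exact/ltW/slope_gt0.
  apply: mulr_ge0; first exact: xss.1.
  by rewrite subr_ge0 ltW // (fixed_pair_lt1 Cstoch i0S cdom xss xsn Fxs S3) // eq_sym.
have [j /setD1P[jp jS]] : exists j, j \in (S :\ p)%SET.
  by apply/card_gt0P; have := cardsD1 p S; have := S3; case: (p \in S) => /=; lia.
rewrite (bigD1 j) //= ltr_pwDl //.
  apply: divr_gt0; last exact: slope_gt0.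
  apply: mulr_gt0; first exact: (fixed_sink_gt0 Cstoch i0S cdom xss xsn Fxs jS).
  by rewrite subr_gt0 (fixed_pair_lt1 Cstoch i0S cdom xss xsn Fxs S3) // eq_sym.
by apply: sumr_ge0 => k /andP[kp _]; apply: term.
Qed.

(** The linearized equilibrium equations.  Eliminating [d j] for every [j] other
    than the top node leaves one equation for [g], whose coefficient is the
    number of [nondegenerate]. *)
Lemma linear_stability : exists2 K, 0 < K &
  forall (d e : 'I_n -> R) (g : R), \sum_i d i = 0 ->
    (forall i, d i * slope i = g * c i 0 + e i) ->
    forall i, `|d i| <= K * \sum_k `|e k|.
Proof.
have [|j|B B0 BP] := @uniform_bound R 'I_n
    (fun j K => j != p -> (slope j)^-1 <= K).
- by move=> i a b aP ab /aP ia; apply: le_trans ia ab.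
- have [->|jp] := eqVneq j p; first by exists 0.
  by exists (slope j)^-1 => //; rewrite invr_ge0 ltW ?slope_gt0.
set N := c p 0 + slope p * \sum_(j | j != p) c j 0 / slope j.
have N0 : 0 < N := nondegenerate.
pose G := (1 + n%:R * B) / N.
have nB : 0 <= n%:R * B by rewrite mulr_ge0 // ltW.
have G0 : 0 <= G by rewrite divr_ge0 ?(ltW N0) // addr_ge0.
pose K0 := B * (G + 1).
have K00 : 0 < K0 by rewrite mulr_gt0 // ltr_wpDl.
have sumn (P : pred 'I_n) (f : 'I_n -> R) m : 0 <= m ->
    (forall i, P i -> f i <= m) -> \sum_(i | P i) f i <= n%:R * m.
  move=> m0 fm; apply: (@le_trans _ _ (\sum_(i < n) m)); last first.
    by rewrite sumr_const card_ord mulr_natl.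
  by rewrite big_mkcond; apply: ler_sum => i _; case: ifP => // /fm.
exists ((1 + n%:R) * K0) => [|d e g d0 dE]; first by rewrite mulr_gt0 // ltr_pwDl.
set E := \sum_k `|e k|.
have E0 : 0 <= E by apply: sumr_ge0.
have eE k : `|e k| <= E by rewrite /E (bigD1 k) //= lerDl sumr_ge0.
have dj j : j != p -> d j = g * (c j 0 / slope j) + e j / slope j.
  move=> jp; have sj := slope_gt0 jp; apply: (mulIf (lt0r_neq0 sj)); rewrite dE.
  by field; apply: lt0r_neq0.
pose Q := \sum_(j | j != p) e j / slope j.
have QE : `|Q| <= n%:R * (B * E).
  apply: le_trans (ler_norm_sum _ _ _) _; apply: sumn.
    by rewrite mulr_ge0 // ltW.
  move=> j jp; rewrite normrM mulrC ler_pM ?eE //.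
  by rewrite normfV gtr0_norm ?slope_gt0 // BP.
have dp : d p = - (g * (\sum_(j | j != p) c j 0 / slope j) + Q).
  have -> : d p = - \sum_(j | j != p) d j.
    by apply/eqP; rewrite -addr_eq0; apply/eqP; rewrite -[RHS]d0 [RHS](bigD1 p).
  congr (- _); rewrite mulr_sumr /Q -big_split /=.
  by apply: eq_bigr => j jp; rewrite dj.
have gN : g * N = - (e p + slope p * Q).
  by have := dE p; rewrite dp /N; lra.
have sp : `|slope p| <= 1.
  have := xss.1 p; have := simplex_le1 p xss; rewrite ler_norml /slope; lra.
have gE : `|g| <= G * E.
  rewrite /G mulrAC ler_pdivlMr // -[X in _ * X](gtr0_norm N0) -normrM gN normrN.
  apply: le_trans (ler_normD _ _) _; rewrite [leRHS]mulrDl mul1r; apply: lerD => //.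
  by rewrite normrM -mulrA; apply: le_trans QE; rewrite ler_piMl.
have djE j : j != p -> `|d j| <= K0 * E.
  move=> jp; rewrite dj // mulrA -mulrDl normrM mulrC /K0 -mulrA.
  apply: ler_pM => //; first by rewrite normfV gtr0_norm ?slope_gt0 // BP.
  apply: le_trans (ler_normD _ _) _; rewrite mulrDl mul1r; apply: lerD => //.
  rewrite normrM; apply: le_trans gE; rewrite ler_piMr //.
  by rewrite ger0_norm ?cdom.2.1 ?simplex_le1 //; exact: cdom.2.
have K0E : 0 <= K0 * E by rewrite mulr_ge0 // ltW.
move=> i; have [->|ip] := eqVneq i p; last first.
  by rewrite -mulrA mulrDl mul1r; apply: le_trans (djE i ip) _; rewrite lerDl mulr_ge0.
have -> : d p = - \sum_(j | j != p) d j.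
  by apply/eqP; rewrite -addr_eq0; apply/eqP; rewrite -[RHS]d0 [RHS](bigD1 p).
rewrite normrN -mulrA mulrDl mul1r; apply: le_trans (ler_norm_sum _ _ _) _.
by apply: le_trans (sumn _ _ _ K0E djE) _; rewrite lerDr.
Qed.

(** The equilibrium equations at [x] hold up to the defect and up to the square
    of the deviation, which is absorbed when the deviation is small. *)
Lemma deviation_le_defect : exists K eta, [/\ 0 < K, 0 < eta &
  forall x, simplex x -> (forall i, `|x i 0 - xs i 0| <= eta) ->
    forall i, `|x i 0 - xs i 0| <= K * defect C x].
Proof.
have [K1 K10 lin] := linear_stability.
have [K2 K20 central] := outflow_almost_central Cstoch i0S cdom.
have n0 : 0 < n%:R :> R by rewrite ltr0n; apply: leq_ltn_trans (ltn_ord i0).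
pose A := n%:R * K1.
have A0 : 0 < A by rewrite mulr_gt0.
exists (2 * A * n%:R * K2), (2 * A)^-1; split; rewrite ?invr_gt0 ?mulr_gt0 //.
move=> x xx near; set de := fun i => x i 0 - xs i 0.
pose be := \sum_k outflow x k; pose bes := \sum_k outflow xs k.
pose e i := outflow x i - c i 0 * be + de i ^+ 2.
have sde : \sum_i de i = 0 by rewrite sumrB xx.2 xss.2 subrr.
have eqs i : de i * slope i = (be - bes) * c i 0 + e i.
  have := fixed_outflow Cstoch i0S cdom i xss Fxs; rewrite -/bes => zs.
  have -> : (be - bes) * c i 0 + e i = outflow x i + de i ^+ 2 - c i 0 * bes.
    by rewrite /e; ring.
  by rewrite -zs /outflow /de /slope; ring.
pose X := \sum_i `|de i|.
have devX i : `|de i| <= K1 * \sum_k `|e k| by apply: lin sde eqs i.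
have d0 : 0 <= defect C x by apply: sumr_ge0.
have eX : \sum_k `|e k| <= n%:R * (K2 * defect C x) + (2 * A)^-1 * X.
  have -> : n%:R * (K2 * defect C x) = \sum_(k < n) K2 * defect C x.
    by rewrite sumr_const card_ord mulr_natl.
  rewrite /X [Y in _ <= _ + Y]mulr_sumr -big_split /=; apply: ler_sum => k _.
  apply: le_trans (ler_normD _ _) _; apply: lerD; first exact: central.
  by rewrite normrX expr2 ler_wpM2r //; exact: near.
have XX : X <= A * (n%:R * (K2 * defect C x) + (2 * A)^-1 * X).
  apply: (@le_trans _ _ (\sum_(i < n) K1 * \sum_k `|e k|)).
    exact: ler_sum.
  rewrite sumr_const card_ord -[_ *+ n]mulr_natl mulrA -/A.
  by rewrite ler_wpM2l // ltW.
have half : A * ((2 * A)^-1 * X) = X / 2 by field; rewrite gt_eqF.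
have Xle : X <= 2 * A * n%:R * K2 * defect C x.
  rewrite mulrDr half in XX.
  have -> : 2 * A * n%:R * K2 * defect C x = 2 * (A * (n%:R * (K2 * defect C x))) by ring.
  lra.
move=> i; apply: le_trans Xle; rewrite /X (bigD1 i) //= lerDl.
exact: sumr_ge0.
Qed.

Variable h : 'I_n -> R.
Hypothesis h_ge0 : forall k, 0 <= h k.
Hypothesis h_sink : forall k, k \in S -> h k = 0.
Hypothesis h_flow : forall ze : 'I_n -> R,
  \sum_j h j * (\sum_k C k j * ze k - ze j) = - \sum_(k | k \notin S) ze k.

Let U := lyapunov C c h.
Let D := dissipation C c h.

Lemma transient_weight_fixed : \sum_k h k * xs k 0 = 0.
Proof.
apply: big1 => k _; have [kS|kS] := boolP (k \in S).
  by rewrite h_sink ?mul0r.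
by rewrite (fixed_off_sink Cstoch i0S cdom xss xsn Fxs kS) mulr0.
Qed.

Lemma potential_taylor (a d : R) : 0 <= a -> 0 <= a + d ->
  potential (a + d) - potential a <= a * (1 - a) * d + d ^+ 2 / 2.
Proof.
move=> a0 ad0; rewrite -subr_ge0.
have -> : a * (1 - a) * d + d ^+ 2 / 2 - (potential (a + d) - potential a) =
  d ^+ 2 * ((2 * a + (a + d)) / 3) by rewrite /potential; field.
by apply: mulr_ge0 (sqr_ge0 _) _; lra.
Qed.

Lemma potential_lipschitz (a b : R) : 0 <= a <= 1 -> 0 <= b <= 1 ->
  potential a - potential b <= `|b - a|.
Proof.
move=> /andP[a0 a1] /andP[b0 b1].
have -> : potential a - potential b =
    (b - a) * ((a ^+ 2 + a * b + b ^+ 2) / 3 - (a + b) / 2).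
  by rewrite /potential; field.
apply: le_trans (ler_norm _) _; rewrite normrM ler_piMr // ler_norml.
have ab := mulr_ge0 a0 b0; have a2 := sqr_ge0 a; have b2 := sqr_ge0 b.
have ab1 : a * b <= 1 by rewrite mulr_ile1.
have a21 : a ^+ 2 <= 1 by rewrite exprn_ile1.
have b21 : b ^+ 2 <= 1 by rewrite exprn_ile1.
lra.
Qed.

(** [U - U xs] has no first-order part in the recurrent directions: the
    densities [outflow xs i / c i] are all equal and the deviations sum to
    minus the transient mass. *)
Lemma energy_le_quadratic : exists2 K, 0 < K & forall x, simplex x ->
  U x - U xs <= K * (\sum_i (x i 0 - xs i 0) ^+ 2 + \sum_(k | k \notin S) x k 0).
Proof.
pose W := leak_weight C c; have W0 : 0 < W := leak_weight_gt0 Cstoch cdom.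
pose H := 1 + \sum_k h k.
have H0 : 0 < H by rewrite ltr_pwDl ?sumr_ge0.
have hH k : h k <= H.
  by rewrite /H (bigD1 k) //= addrCA lerDl addr_ge0 ?sumr_ge0.
exists (W + W * H) => [|x xx]; first by rewrite addr_gt0 ?mulr_gt0.
pose be := \sum_k outflow xs k.
have be0 : 0 < be := fixed_total_outflow_gt0 xss xsn.
set Q := \sum_i _; set y := \sum_(_ | _) _.
have y0 : 0 <= y by apply: sumr_ge0 => k _; apply: xx.1.
have Q0 : 0 <= Q by apply: sumr_ge0 => k _; apply: sqr_ge0.
rewrite /U /lyapunov transient_weight_fixed mulr0 addr0.
set V := \sum_(i in _) _; set V' := \sum_(i in _) _.
have sS : \sum_(i in S) (x i 0 - xs i 0) = - y.
  have := xx.2; have := xss.2; rewrite [in X in X -> _](bigID (mem S)) /=.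
  rewrite [X in _ + X]big1 => [|k kS]; last first.
    exact: (fixed_off_sink Cstoch i0S cdom xss xsn Fxs kS).
  by rewrite [X in _ -> X = _ -> _](bigID (mem S)) /= -/y sumrB => <-; lra.
have VV : V - V' <= W * Q - be * y.
  have -> : - (be * y) = \sum_(i in S) be * (x i 0 - xs i 0)
    by rewrite -mulr_sumr sS mulrN.
  have WQ : \sum_(i in S) (c i 0)^-1 * (x i 0 - xs i 0) ^+ 2 <= W * Q.
    apply: (@le_trans _ _ (\sum_(i in S) W * (x i 0 - xs i 0) ^+ 2)).
      apply: ler_sum => i iS; rewrite ler_wpM2r ?sqr_ge0 //.
      rewrite /W /leak_weight (bigD1 i) //= addrCA lerDl addr_ge0 // sumr_ge0 //.
      by move=> j /andP[jS _]; rewrite invr_ge0 ltW // (centrality_gt0 Cstoch cdom).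
    rewrite -mulr_sumr ler_wpM2l ?(ltW W0) // /Q [leRHS](bigID (mem S)) /= lerDl.
    by apply: sumr_ge0 => k _; apply: sqr_ge0.
  apply: (@le_trans _ _ (\sum_(i in S) ((c i 0)^-1 * (x i 0 - xs i 0) ^+ 2
      + be * (x i 0 - xs i 0)))); last by rewrite big_split /= lerD2r.
  rewrite /V /V' -sumrB; apply: ler_sum => i iS; rewrite -mulrBl.
  have ci : 0 < c i 0 by exact: (centrality_gt0 Cstoch cdom iS).
  rewrite ler_pdivrMr //.
  have xi : x i 0 = xs i 0 + (x i 0 - xs i 0) by ring.
  have xi0 : 0 <= xs i 0 + (x i 0 - xs i 0) by rewrite -xi xx.1.
  have := potential_taylor (xss.1 i) xi0; rewrite -xi -/(outflow xs i).
  rewrite (fixed_outflow Cstoch i0S cdom i xss Fxs) -/be => tay.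
  apply: le_trans tay _; set d := x i 0 - xs i 0.
  have -> : ((c i 0)^-1 * d ^+ 2 + be * d) * c i 0 = d ^+ 2 + c i 0 * be * d.
    by field; apply: lt0r_neq0.
  by have := sqr_ge0 d; lra.
have HW : \sum_k h k * x k 0 <= H * y.
  rewrite (bigID (mem S)) /= big1 => [|k kS]; last by rewrite h_sink ?mul0r.
  by rewrite add0r mulr_sumr; apply: ler_sum => k _; rewrite ler_wpM2r ?xx.1.
have WHW := ler_wpM2l (ltW W0) HW.
have bey := mulr_ge0 (ltW be0) y0; have Wy := mulr_ge0 (ltW W0) y0.
have WHQ : 0 <= W * H * Q by rewrite !mulr_ge0 // ltW.
by rewrite -/W; lra.
Qed.

Lemma energy_lower_bound : exists2 K, 0 < K & forall x, simplex x ->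
  U xs - U x <= K * \sum_i `|x i 0 - xs i 0|.
Proof.
pose W := leak_weight C c; have W0 : 0 < W := leak_weight_gt0 Cstoch cdom.
exists W => // x xx; rewrite /U /lyapunov transient_weight_fixed mulr0 addr0.
have hx : 0 <= leak_weight C c * \sum_k h k * x k 0.
  by apply: mulr_ge0 (ltW W0) _; apply: sumr_ge0 => k _; rewrite mulr_ge0 ?xx.1.
suff : \sum_(i in S) potential (xs i 0) / c i 0
    - \sum_(i in S) potential (x i 0) / c i 0
    <= W * \sum_i `|x i 0 - xs i 0| by lra.
rewrite -sumrB mulr_sumr [leRHS](bigID (mem S)) /=.
apply: ler_wpDr; first by apply: sumr_ge0 => k _; rewrite mulr_ge0 // ltW.
apply: ler_sum => i iS; rewrite -mulrBl mulrC.
have ci : 0 < (c i 0)^-1 by rewrite invr_gt0 (centrality_gt0 Cstoch cdom).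
have cW : (c i 0)^-1 <= W.
  rewrite /W /leak_weight (bigD1 i) //= addrCA lerDl addr_ge0 // sumr_ge0 //.
  by move=> j /andP[jS _]; rewrite invr_ge0 ltW // (centrality_gt0 Cstoch cdom).
apply: (@le_trans _ _ ((c i 0)^-1 * `|x i 0 - xs i 0|)); last by rewrite ler_wpM2r.
rewrite ler_pM2l //; apply: potential_lipschitz.
  by rewrite xss.1 simplex_le1.
by rewrite xx.1 simplex_le1.
Qed.

(** Close to [xs] the dissipation controls the square of the defect, hence the
    square of the deviation, and the transient mass; these two control the
    energy. *)
Lemma near_equilibrium : exists K eta, [/\ 0 < K, 0 < eta &
  forall x, simplex x -> (forall i, `|x i 0 - xs i 0| <= eta) ->
    U x - U xs <= K * D x /\
    forall i, (x i 0 - xs i 0) ^+ 2 <= K * D x].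
Proof.
have [K1 [eta1 [K10 eta10 dev]]] := deviation_le_defect.
have [K2 K20 energy] := energy_le_quadratic.
have [a b|i|mu mu0 muP] := @uniform_positive R 'I_n
    (fun i m => i \in S -> m <= xs i 0).
- by move=> i aP /andP[_ ib] /aP; apply: le_trans.
- have [iS|iS] := boolP (i \in S); last by exists 1.
  exists (xs i 0) => //; exact: (fixed_sink_gt0 Cstoch i0S cdom xss xsn Fxs iS).
have n0 : 0 <= n%:R :> R by [].
pose K3 := 6 / mu + 2.
have K30 : 0 < K3 by rewrite addr_gt0 ?divr_gt0.
pose K4 := (K1 * n%:R) ^+ 2 * K3.
have K40 : 0 <= K4 by rewrite mulr_ge0 ?sqr_ge0 // ltW.
have K54 : K4 <= K2 * (n%:R * K4 + 2) + K4.
  by rewrite lerDr mulr_ge0 ?addr_ge0 ?mulr_ge0 // ltW.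
exists (K2 * (n%:R * K4 + 2) + K4), (Num.min eta1 (Num.min (mu / 2) 2^-1)); split.
- apply: ltr_pwDl => //; apply: mulr_gt0 => //; apply: ltr_wpDl => //.
  exact: mulr_ge0.
- have mu2 : 0 < mu / 2 by rewrite divr_gt0.
  by rewrite !lt_min eta10 mu2 invr_gt0 ltr0n.
move=> x xx near.
have near1 i : `|x i 0 - xs i 0| <= eta1.
  by have := near i; rewrite !le_min => /and3P[].
have near2 i : i \in S -> mu / 2 <= x i 0.
  move=> iS; have := near i; rewrite !le_min => /and3P[_ + _].
  by have := muP i iS; rewrite ler_norml; lra.
have near3 i : i \notin S -> x i 0 <= 2^-1.
  move=> iS; have := near i; rewrite !le_min => /and3P[_ _].
  by rewrite (fixed_off_sink Cstoch i0S cdom xss xsn Fxs iS) ler_norml; lra.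
have D0 : 0 <= D x := dissipation_ge0 Cstoch i0S cdom h_flow xx.
have leakD : leak C x <= D x := leak_le_dissipation Cstoch i0S cdom h_flow xx.
have leak0 : 0 <= leak C x := leak_ge0 C xx.
have leak1 : leak C x <= 1.
  rewrite -xx.2 [leRHS](bigID (mem S)) /= ler_wpDl ?sumr_ge0 // => [k _|].
    exact: xx.1.
  by apply: ler_sum => k _; apply: outflow_le.
have innerD i : i \in S -> inner_incr C x i ^+ 2 <= 3 / mu * D x.
  move=> iS; have := square_le_dissipation Cstoch i0S cdom h_flow xx iS.
  move=> sqD; rewrite [leRHS]mulrAC ler_pdivlMr //; move: sqD; have := near2 i iS.
  have := sqr_ge0 (inner_incr C x i); set q := _ ^+ 2 => q0 xi.
  have := ler_wpM2r q0 xi; rewrite -/(D x); lra.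
pose b := Num.sqrt (K3 * D x).
have KD0 : 0 <= K3 * D x by rewrite mulr_ge0 // ltW.
have b0 : 0 <= b by exact: sqrtr_ge0.
have b2 : b ^+ 2 = K3 * D x by rewrite sqr_sqrtr.
have stepb i : `|DF_map C x i 0 - x i 0| <= b.
  apply: le_trans (step_le_inner Cstoch i xx) _.
  rewrite -(@ler_pXn2r _ 2) ?nnegrE ?addr_ge0 ?mulr_ge0 // b2.
  set s := _ * `|_|; have s2 : s ^+ 2 <= 3 / mu * D x.
    rewrite /s; have [iS|iS] := boolP (i \in S).
      by rewrite mul1r real_normK ?num_real // innerD.
    by rewrite mul0r expr0n /= mulr_ge0 // divr_ge0 // ltW.
  have l2 : leak C x ^+ 2 <= D x.
    by apply: le_trans leakD; rewrite expr2 ler_piMr.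
  have := sqr_ge0 (s - leak C x).
  have -> : K3 * D x = 2 * (3 / mu * D x) + 2 * D x by rewrite /K3; ring.
  lra.
have devb i : `|x i 0 - xs i 0| <= K1 * n%:R * b.
  apply: le_trans (dev x xx near1 i) _; rewrite -mulrA ler_wpM2l ?(ltW K10) //.
  rewrite mulr_natl -[X in _ *+ X]card_ord -sumr_const.
  by apply: ler_sum => k _.
have devD i : (x i 0 - xs i 0) ^+ 2 <= K4 * D x.
  rewrite -(real_normK (num_real (x i 0 - xs i 0))).
  have -> : K4 * D x = (K1 * n%:R * b) ^+ 2 by rewrite [RHS]exprMn b2 mulrA.
  by rewrite ler_pXn2r ?nnegrE // mulr_ge0 // mulr_ge0 // ltW.
split=> [|i]; last by apply: le_trans (devD i) _; rewrite ler_wpM2r.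
apply: le_trans (energy x xx) _.
have sq : \sum_i (x i 0 - xs i 0) ^+ 2 <= n%:R * (K4 * D x).
  by rewrite mulr_natl -[X in _ *+ X]card_ord -sumr_const; apply: ler_sum => k _.
have tr : \sum_(k | k \notin S) x k 0 <= 2 * D x.
  apply: (@le_trans _ _ (2 * leak C x)); last by rewrite ler_pM2l.
  rewrite /leak mulr_sumr; apply: ler_sum => k kS.
  have := mulr_ge0 (xx.1 k) (_ : 0 <= 2^-1 - x k 0); rewrite subr_ge0 near3 //.
  by move=> /(_ isT); rewrite /outflow; lra.
have := ler_wpM2l (ltW K20) (lerD sq tr); have := mulr_ge0 K40 D0; lra.
Qed.

Variable x0 : 'cV[R]_n.
Hypothesis x0s : simplex x0.
Let x := self_weights C x0.

(** The energy above [xs] is nonnegative, because it decreases and tends to 0;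
    so the local bound of the energy by its own decrease makes it decay
    geometrically, and the deviations decay with its square root. *)
Lemma exponential_rate :
    (forall j e, 0 < e -> exists T, forall t, (T <= t)%N -> `|x t j 0 - xs j 0| <= e) ->
  exists M rho, [/\ 0 < M, 0 < rho < 1 &
    forall t i, `|x t i 0 - xs i 0| <= M * rho ^+ t].
Proof.
move=> conv; have xx t : simplex (x t) by exact: orbit_simplex.
have convu e : 0 < e -> exists T, forall t i, (T <= t)%N -> `|x t i 0 - xs i 0| <= e.
  move=> e0; have /fin_all_exists[f fP] (j : 'I_n) := conv j e e0.
  exists (\max_j f j) => t i Tt; apply: fP; apply: leq_trans Tt.
  exact: leq_bigmax.
pose E t := U (x t) - U xs.
have Estep t : E t - E t.+1 = D (x t).
  have xS : x t.+1 = DF_map C (x t) by [].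
  by rewrite /E /D /dissipation -/U xS; ring.
have D0 t : 0 <= D (x t) by exact: (dissipation_ge0 Cstoch i0S cdom h_flow (xx t)).
have Emono t k : E (k + t)%N <= E t.
  elim: k => [//|k IH]; apply: le_trans IH.
  by have := D0 (k + t)%N; have := Estep (k + t)%N; rewrite addSn; lra.
have n0 : 0 < n%:R :> R by rewrite ltr0n; apply: leq_ltn_trans (ltn_ord i0).
have E0 t : 0 <= E t.
  rewrite leNgt; apply/negP => Et; have [L L0 low] := energy_lower_bound.
  have a0 : 0 < - E t / 2 / L / n%:R by rewrite !divr_gt0 // oppr_gt0.
  have [T TP] := convu _ a0.
  have dev : \sum_i `|x (T + t)%N i 0 - xs i 0| <= - E t / 2 / L.
    rewrite -[leRHS](divfK (lt0r_neq0 n0)) mulrC mulr_natl.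
    rewrite -[X in _ *+ X]card_ord -sumr_const; apply: ler_sum => i _.
    by apply: TP; rewrite leq_addr.
  have := low _ (xx (T + t)%N); have := Emono t T.
  have := ler_wpM2l (ltW L0) dev.
  have -> : L * (- E t / 2 / L) = - E t / 2 by field; apply: lt0r_neq0.
  by rewrite /E; move: Et; rewrite /E; lra.
have [K [eta [K0 eta0 near]]] := near_equilibrium.
have [T TP] := convu _ eta0.
have ED t : (T <= t)%N -> E t <= K * D (x t).
  by move=> Tt; have [] := near _ (xx t) (fun i => TP t i Tt).
have devD t i : (T <= t)%N -> (x t i 0 - xs i 0) ^+ 2 <= K * D (x t).
  by move=> Tt; have [_] := near _ (xx t) (fun i => TP t i Tt); apply.
pose r := K / (K + 1).
have K1 : 0 < K + 1 by rewrite addr_gt0.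
have r0 : 0 < r by rewrite divr_gt0.
have r1 : r < 1 by rewrite ltr_pdivrMr // mul1r ltrDl.
have contr t : (T <= t)%N -> E t.+1 <= r * E t.
  move=> Tt; rewrite /r mulrAC ler_pdivlMr //.
  by have := ED t Tt; have := D0 t; rewrite -Estep; have := E0 t.+1; lra.
have [M0 M00 M0P] := geometric_bound r0 contr.
pose rho := Num.sqrt r.
have rho0 : 0 < rho by rewrite sqrtr_gt0.
have rho1 : rho < 1 by rewrite -sqrtr1 ltr_sqrt.
have rho2 t : rho ^+ t ^+ 2 = r ^+ t by rewrite -exprM mulnC exprM sqr_sqrtr // ltW.
(* [rho ^- T] covers the times before the orbit is close to [xs] *)
pose M1 := Num.sqrt (K * M0).
have KM0 : 0 < K * M0 by rewrite mulr_gt0.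
have M10 : 0 < M1 by rewrite sqrtr_gt0.
exists (M1 + rho ^- T), rho; split; rewrite ?rho0 ?addr_gt0 ?invr_gt0 ?exprn_gt0 //.
move=> t i; apply: geometric_tail => //; rewrite ?(ltW rho1) ?(ltW M10) //.
  exact: simplex_dist_le1.
move=> Tt.
rewrite -(@ler_pXn2r _ 2) ?nnegrE ?mulr_ge0 ?exprn_ge0 ?(ltW rho0) ?(ltW M10) //.
rewrite real_normK ?num_real // exprMn rho2 sqr_sqrtr ?(ltW KM0) //.
apply: le_trans (devD t i Tt) _; rewrite -mulrA ler_pM2l //.
by apply: le_trans (M0P t); have := Estep t; have := E0 t.+1; lra.
Qed.

End Rate.

(** * Entrywise convergence, stars and confinement of orbits *)

Section MatrixNorm.
Variables (R : realType) (n : nat).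

Lemma col_norm_le (v : 'cV[R]_n) m : 0 <= m -> (forall i, `|v i 0| <= m) ->
  `|v| <= m.
Proof.
move=> m0 vm; rewrite [leLHS]/Num.norm /= mx_normrE.
by apply/bigmax_leP; split=> // -[i j] _ /=; rewrite ord1.
Qed.

Lemma entrywise_exponential (u : nat -> 'cV[R]_n) (l : 'cV[R]_n) (M rho : R) : 0 < M ->
    0 < rho < 1 -> (forall t i, `|u t i 0 - l i 0| <= M * rho ^+ t) ->
  converges_exponentially u l.
Proof.
move=> M0 rho01 ul; exists M, rho; split=> // t.
have /andP[rho0 _] := rho01.
apply: col_norm_le => [|i]; first by rewrite mulr_ge0 ?exprn_ge0 // ltW.
by rewrite !mxE.
Qed.

Lemma entrywise_cvg (u : nat -> 'cV[R]_n) (l : 'cV[R]_n) :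
    (forall j e, 0 < e ->
       exists T, forall t, (T <= t)%N -> `|u t j 0 - l j 0| <= e) ->
  u @ \oo --> l.
Proof.
move=> ul; apply/cvgrPdist_le => e e0.
have /fin_all_exists[T TP] (j : 'I_n) := ul j e e0.
exists (\max_j T j)%N => // t /= Tt; apply: col_norm_le (ltW e0) _ => i.
rewrite !mxE distrC; apply: TP; apply: leq_trans Tt.
exact: leq_bigmax.
Qed.

End MatrixNorm.

Section Star.
Variables (R : realType) (n : nat) (C : 'M[R]_n).
Hypothesis Cstoch : row_stochastic C.
Hypothesis Cdiag : forall i, C i i = 0.
Let S := globally_reachable_nodes (digraph C).
Variable i0 : 'I_n.
Hypothesis i0S : i0 \in S.
Variable c : 'cV[R]_n.
Hypothesis cdom : dominant_left_eigenvector C c.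
Let Gr := induced_subgraph (digraph C) S.

Lemma centrality_others k : \sum_(j | j != k) C j k * c j 0 = c k 0.
Proof. by rewrite -[RHS](dominant_fixed k cdom) [RHS](bigD1 k) //= Cdiag mul0r add0r. Qed.

(** In a star all the stationary flow goes to the center at every other step. *)
Lemma star_centrality k : star_topology Gr k -> c (val k) 0 = 2^-1.
Proof.
move=> star; set a := val k; have aS : a \in S := valP k.
suff : c a 0 = 1 - c a 0 by lra.
rewrite -[LHS]centrality_others -(simplex_others a cdom.2).
apply: eq_bigr => j ja; have [jS|jS] := boolP (j \in S); last first.
  by rewrite (dominant_off_sink Cstoch i0S cdom jS) mulr0.
suff -> : C j a = 1 by rewrite mul1r.
rewrite -(stoch_sum1 Cstoch j) (bigD1 a) //= big1 ?addr0 // => l la.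
have [lS|lS] := boolP (l \in S); last exact: (sink_closed Cstoch jS lS).
apply/eqP; rewrite eq_le stoch_ge0 // andbT leNgt; apply/negP => Cjl.
have [] := star (Sub j jS) (Sub l lS) Cjl => /(congr1 val) /= /eqP.
  by rewrite (negbTE ja).
by rewrite (negbTE la).
Qed.

(** A node receives at most the whole flow of the others; centrality 1/2 forces
    every edge of the class to lead to it or leave it. *)
Lemma half_centrality_star (k : {i : 'I_n | i \in S}) :
  2^-1 <= c (val k) 0 -> star_topology Gr k.
Proof.
set a := val k => ca.
have toa j : j != a -> (1 - C j a) * c j 0 = 0.
  move: j; apply: psumr_eq0P => [j _|].
    by rewrite mulr_ge0 ?subr_ge0 ?stoch_le1 //; exact: cdom.2.1.
  apply/eqP; rewrite eq_le sumr_ge0 ?andbT => [|j _]; last first.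
    by rewrite mulr_ge0 ?subr_ge0 ?stoch_le1 //; exact: cdom.2.1.
  under eq_bigr do rewrite mulrBl mul1r.
  by rewrite sumrB centrality_others (simplex_others a cdom.2); lra.
move=> i j Cij; have [->|ik] := eqVneq i k; first by left.
right; apply/val_inj/eqP; rewrite -/a; apply: contraTT Cij => ja.
have ia : val i != a by [].
have Cia : C (val i) a = 1.
  have := toa _ ia => /eqP; rewrite mulf_eq0 subr_eq0 orbC.
  by rewrite gt_eqF ?(centrality_gt0 Cstoch cdom (valP i)) //= => /eqP.
rewrite /= -leNgt -(lerD2l 1) addr0 -{1}Cia -(stoch_sum1 Cstoch (val i)).
rewrite (bigD1 a) //= lerD2l (bigD1 (val j)) //= lerDl sumr_ge0 // => l _.
exact: stoch_ge0.
Qed.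

End Star.

Section Trapping.
Variables (R : realType) (n : nat) (C : 'M[R]_n).
Hypothesis Cstoch : row_stochastic C.
Let S := globally_reachable_nodes (digraph C).
Variable i0 : 'I_n.
Hypothesis i0S : i0 \in S.
Variable c : 'cV[R]_n.
Hypothesis cdom : dominant_left_eigenvector C c.
Variable x0 : 'cV[R]_n.
Hypotheses (x0s : simplex x0) (x0n : ~ autocratic x0).
Let x := self_weights C x0.

(** Nodes outside the recurrent class have centrality 0; they are kept away from
    1 by the mass that the class holds, the others by repulsion. *)
Lemma orbit_trapped : exists T e, 0 < e /\
  forall t i, (T <= t)%N -> c i 0 < 2^-1 -> x t i 0 <= 1 - e.
Proof.
have [T [s [s0 sP]]] := transient_mass_bounded Cstoch x0s x0n i0S.
have [i a b|i|e e0 eP] := @uniform_positive R 'I_n (fun i e =>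
    forall t, (T <= t)%N -> c i 0 < 2^-1 -> x t i 0 <= 1 - e).
- move=> aP /andP[_ ba] t Tt ci; apply: le_trans (aP t Tt ci) _.
  by rewrite lerD2l lerN2.
- have [iS|iS] := boolP (i \in S); last first.
    exists s => // t Tt _; apply: le_trans (sP t Tt).
    rewrite (bigD1 i) //= lerDl sumr_ge0 // => k _.
    exact: (orbit_simplex Cstoch x0s t).1.
  have [ci|ci] := ltP (c i 0) 2^-1; last by exists 1.
  have [e e0 eP] := autocrat_repels Cstoch x0s x0n cdom iS ci.
  by exists e => // t _ _; apply: eP.
by exists T, e; split=> // t i; apply: eP.
Qed.

(** The upper bounds [b] confine the orbit, from some time on, to a compact region
    in which the autocratic configurations of all nodes of centrality less than
    1/2 are excluded. *)
Lemma trapped_limits :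
  exists2 b : 'I_n -> R, forall i, c i 0 < 2^-1 -> b i < 1 &
    (exists z, [/\ simplex z, DF_map C z = z & forall i, z i 0 <= b i]) /\
    forall y, (forall z, simplex z -> DF_map C z = z ->
        (forall i, z i 0 <= b i) -> z = y) ->
      forall j e, 0 < e ->
        exists T, forall t, (T <= t)%N -> `|x t j 0 - y j 0| <= e.
Proof.
have [T [e [e0 eP]]] := orbit_trapped.
have [h [h0 _ _ hflow]] := sink_hitting_flow Cstoch i0S.
pose b i : R := if c i 0 < 2^-1 then 1 - e else 1.
have trap t i : (T <= t)%N -> x t i 0 <= b i.
  move=> Tt; rewrite /b; case: ifP => [|_]; first exact: eP.
  by apply: simplex_le1; apply: orbit_simplex.
exists b => [i ci|]; first by rewrite /b ci; lra.
split; first exact: (trapped_equilibrium Cstoch i0S cdom h0 hflow x0s trap).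
by move=> y yP j e1 e10; apply: (trapped_convergence Cstoch i0S cdom h0 hflow x0s trap).
Qed.

End Trapping.

(** * Recurrent class with two nodes *)

Section TwoNodes.
Variables (R : realType) (n : nat) (C : 'M[R]_n).
Hypothesis Cstoch : row_stochastic C.
Hypothesis Cdiag : forall i, C i i = 0.
Let S := globally_reachable_nodes (digraph C).
Variables o0 o1 : 'I_n.
Hypotheses (o0E : val o0 = 0%N) (o1E : val o1 = 1%N).

Let o01 : o0 != o1. Proof. by rewrite -val_eqE o0E o1E. Qed.

Lemma two_node_pointE (a : R) i : two_node_point n a i 0 =
  if i == o0 then a else if i == o1 then 1 - a else 0.
Proof. by rewrite mxE -!val_eqE o0E o1E. Qed.

Lemma sum_two_nodes (f : 'I_n -> R) :
  \sum_i f i = f o0 + (f o1 + \sum_(i | (i != o0) && (i != o1)) f i).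
Proof. by rewrite (bigD1 o0) // (bigD1 o1) 1?eq_sym. Qed.

Lemma two_node_simplex (a : R) : 0 <= a <= 1 -> simplex (two_node_point n a).
Proof.
move=> /andP[a0 a1]; split=> [i|].
  by rewrite two_node_pointE; case: ifP => // _; case: ifP; lra.
rewrite sum_two_nodes big1 => [|i /andP[i_0 i_1]]; last first.
  by rewrite two_node_pointE (negbTE i_0) (negbTE i_1).
by rewrite !two_node_pointE eqxx eq_sym (negbTE o01) eqxx; ring.
Qed.

Lemma interior_point_nonautocratic (a : R) : 0 < a < 1 ->
  ~ autocratic (two_node_point n a).
Proof.
move=> /andP[a0 a1]; have s : simplex (two_node_point n a).
  by apply: two_node_simplex; lra.
apply/(autocraticP s) => i; rewrite two_node_pointE.
by case: ifP => // _; case: ifP; lra.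
Qed.

Hypothesis SE : S = [set o0; o1]%SET.

Let o0S : o0 \in S. Proof. by rewrite SE !inE eqxx. Qed.
Let o1S : o1 \in S. Proof. by rewrite SE !inE eqxx orbT. Qed.

Lemma notin_two_nodes i : (i \notin S) = (i != o0) && (i != o1).
Proof. by rewrite SE !inE negb_or. Qed.

Lemma two_node_swap : C o0 o1 = 1 /\ C o1 o0 = 1.
Proof.
have sums i : \sum_(j in S) C i j = C i o0 + C i o1.
  by rewrite SE big_setU1 ?big_set1 // inE.
have := sink_row_sum Cstoch o0S; have := sink_row_sum Cstoch o1S.
by rewrite !sums !Cdiag add0r addr0.
Qed.

Lemma two_node_fixed (a : R) : DF_map C (two_node_point n a) = two_node_point n a.
Proof.
have [C01 C10] := two_node_swap; set y := two_node_point n a.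
have y0 : y o0 0 = a by rewrite two_node_pointE eqxx.
have y1 : y o1 0 = 1 - a by rewrite two_node_pointE eq_sym (negbTE o01) eqxx.
have yN i : i \notin S -> outflow y i = 0.
  rewrite notin_two_nodes => /andP[i_0 i_1]; rewrite /outflow two_node_pointE.
  by rewrite (negbTE i_0) (negbTE i_1) mul0r.
apply/colP => j; apply/eqP; rewrite -subr_eq0 DF_incr sum_two_nodes; apply/eqP.
rewrite big1 => [|i]; last by rewrite -notin_two_nodes => /yN->; rewrite mulr0.
have [->|j0] := eqVneq j o0.
  by rewrite Cdiag C10 /outflow y0 y1; ring.
have [->|j1] := eqVneq j o1.
  by rewrite Cdiag C01 /outflow y0 y1; ring.
have jS : j \notin S by rewrite notin_two_nodes j0.
rewrite (sink_closed Cstoch o0S jS) (sink_closed Cstoch o1S jS) (yN j jS); ring.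
Qed.

Lemma two_node_equilibria : equilibria C = autocratic `|` two_node_family.
Proof.
apply/seteqP; split=> [x [xs Fx]|x [[i _ <-]|[a a01 <-]]]; last 2 first.
- by split; [exact: simplex_delta|exact: DF_delta].
- by split; [exact: two_node_simplex|exact: two_node_fixed].
have [xa|xn] := pselect (autocratic x); [by left|right].
have [c cdom] := dominant_left_eigenvector_exists Cstoch o0.
have xN i : i \notin S -> x i 0 = 0 by exact: (fixed_off_sink Cstoch o0S cdom xs xn Fx).
have := xs.2; rewrite sum_two_nodes big1 => [|i]; last first.
  by rewrite -notin_two_nodes => /xN.
rewrite addr0 => x01; exists (x o0 0).
  by rewrite /= xs.1 simplex_le1.
apply/colP => i; rewrite two_node_pointE; have [->//|i_0] := eqVneq i o0.
have [->|i_1] := eqVneq i o1; first lra.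
by rewrite xN // notin_two_nodes i_0.
Qed.

(** The two nodes exchange their outflows, so the share of the first one only
    changes by an amount controlled by the transient mass.  This change is at
    most a multiple of the decrease of a weighted transient mass [W], so adding
    or subtracting that multiple of [W] makes the share monotone. *)
Lemma two_node_convergence x0 : simplex x0 -> ~ autocratic x0 ->
  exists2 xs, two_node_family xs & converges_exponentially (self_weights C x0) xs.
Proof.
move=> x0s x0n; have [C01 C10] := two_node_swap.
pose x := self_weights C x0.
have xs t : simplex (x t) by exact: orbit_simplex.
have [h [h0 hS h1 hflow]] := sink_hitting_flow Cstoch o0S.
pose W t := \sum_k h k * x t k 0.
pose y t := \sum_(k | k \notin S) x t k 0.
have y0 t : 0 <= y t by apply: sumr_ge0 => k _; exact: (xs t).1.
have W0 t : 0 <= W t by apply: sumr_ge0 => k _; rewrite mulr_ge0 ?(xs t).1.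
have WE t : W t = \sum_(k | k \notin S) h k * x t k 0.
  by rewrite /W (bigID (mem S)) /= big1 ?add0r // => k kS; rewrite hS ?mul0r.
have yW t : y t <= W t.
  by rewrite WE; apply: ler_sum => k kS; rewrite ler_peMl ?h1 ?(xs t).1.
have Wstep t : W t.+1 = W t - leak C (x t).
  exact: (transient_mass_decrease hflow).
have [T [s [s0 sP]]] := transient_mass_bounded Cstoch x0s x0n o0S.
have s1 : s <= 1 by have := sP T (leqnn _); have := y0 T; rewrite /y -/x; lra.
have leak_y t : (T <= t)%N -> s * y t <= leak C (x t).
  move=> Tt; rewrite mulr_sumr; apply: ler_sum => k kS.
  rewrite /outflow mulrC ler_wpM2l ?(xs t).1 //.
  suff : x t k 0 <= 1 - s by lra.
  apply: le_trans (sP t Tt); rewrite (bigD1 k) //= lerDl sumr_ge0 // => l _.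
  exact: (xs t).1.
(* the 2 keeps [rho] positive even without transient nodes *)
pose H := 2 + \sum_k h k.
have H2 : 2 <= H by rewrite lerDl sumr_ge0.
have H0 : 0 < H by lra.
have WH t : W t <= H * y t.
  rewrite WE mulr_sumr; apply: ler_sum => k kS; rewrite ler_wpM2r ?(xs t).1 //.
  by rewrite /H (bigD1 k) //= addrCA lerDl addr_ge0 // sumr_ge0.
pose rho := 1 - s / H.
have sH0 : 0 < s / H by rewrite divr_gt0.
have sH1 : s / H < 1 by rewrite ltr_pdivrMr //; lra.
have rho0 : 0 < rho by rewrite /rho; lra.
have rho1 : rho < 1 by rewrite /rho; lra.
have [|M M0 MP] := @geometric_bound R W rho T rho0.
  move=> t Tt; rewrite Wstep /rho mulrBl mul1r lerD2l lerN2.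
  apply: le_trans (leak_y t Tt); rewrite -mulrA ler_pM2l // ler_pdivrMl //.
pose ka := s^-1 + 1.
have ka1 : 1 <= ka by rewrite lerDr invr_ge0 ltW.
have ka0 : 0 <= ka by lra.
have yka t : (T <= t)%N -> y t + leak C (x t) <= ka * leak C (x t).
  by move=> Tt; rewrite mulrDl mul1r lerD2r ler_pdivlMl // leak_y.
pose a t := x t o0 0.
have astep t : (T <= t)%N -> `|a t.+1 - a t| <= ka * (W t - W t.+1).
  move=> Tt; rewrite Wstep opprB addrCA subrr addr0.
  apply: le_trans (yka t Tt); rewrite /a -[x t.+1]/(DF_map C (x t)) DF_incr.
  rewrite sum_two_nodes Cdiag C10.
  set q := \sum_(_ | _) _; have q0 : 0 <= q by exact: inflow_ge0.
  have ql : q <= leak C (x t).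
    rewrite /leak (eq_bigl (fun i => (i != o0) && (i != o1))).
      exact: inflow_le.
    by move=> i; rewrite -/S notin_two_nodes.
  have yE : y t = 1 - x t o0 0 - x t o1 0.
    rewrite /y (eq_bigl _ _ notin_two_nodes).
    by have := (xs t).2; rewrite sum_two_nodes; lra.
  have -> : 0 * outflow (x t) o0 + (1 * outflow (x t) o1 + q) - outflow (x t) o0
     = (x t o1 0 - x t o0 0) * y t + q by rewrite yE /outflow; ring.
  apply: le_trans (ler_normD _ _) _; apply: lerD; last by rewrite ger0_norm.
  rewrite normrM (ger0_norm (y0 t)) ler_piMl //.
  have := (xs t).1 o0; have := (xs t).1 o1; have := simplex_le1 o0 (xs t).
  by have := simplex_le1 o1 (xs t); rewrite ler_norml; lra.
have [||l [l0 lP lim]] := @nonincreasing_limit R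
  (fun t => a (T + t)%N + ka * W (T + t)%N).
- by move=> t; rewrite addr_ge0 ?mulr_ge0 //; exact: (xs _).1.
- move=> t; have := astep _ (leq_addr t T); rewrite addnS ler_norml; lra.
have aW t : (T <= t)%N -> `|a t - l| <= ka * W t.
  move=> Tt; have mono k : a t - ka * W t <= a (t + k)%N - ka * W (t + k)%N.
    elim: k => [|k IH]; first by rewrite addn0.
    apply: le_trans IH _; have := astep _ (leq_trans Tt (leq_addr k t)).
    by rewrite addnS ler_norml; lra.
  have := lP (t - T)%N; rewrite subnKC // => up.
  suff : a t - ka * W t <= l by rewrite ler_norml; lra.
  apply/ler_addgt0Pr => e e0; have [T1 T1P] := lim e e0.
  have := T1P (t - T + T1)%N (leq_addl _ _); rewrite addnA subnKC //.
  have := mono T1; have := mulr_ge0 ka0 (W0 (t + T1)%N); lra.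
have l1 : l <= 1.
  apply/ler_addgt0Pr => e e0.
  have kM : 0 < ka * M by rewrite mulr_gt0 //; lra.
  have /cvgrPdist_le/(_ e e0)[T1 _ T1P] : (ka * M) * rho ^+ t @[t --> \oo] --> 0.
    apply: (@cvg_geometric _ (ka * M) rho); rewrite ger0_norm //; exact: ltW.
  have := T1P (maxn T T1) (leq_maxr _ _); rewrite /= sub0r normrN ger0_norm; last first.
    by rewrite mulr_ge0 ?exprn_ge0 // ltW.
  have := aW _ (leq_maxl T T1); have := ler_wpM2l ka0 (MP (maxn T T1)).
  have := simplex_le1 o0 (xs (maxn T T1)).
  by rewrite mulrA /a ler_norml; lra.
have sl : simplex (two_node_point n l) by apply: two_node_simplex; lra.
have M1 : 0 < (ka + 1) * M by rewrite mulr_gt0 //; lra.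
exists (two_node_point n l); first by exists l => //=; lra.
apply: (@entrywise_exponential _ _ _ _ ((ka + 1) * M + rho ^- T) rho).
- by rewrite addr_gt0 ?invr_gt0 ?exprn_gt0.
- by rewrite rho0.
move=> t i; apply: geometric_tail => //; rewrite ?(ltW rho1) ?(ltW M1) //.
  exact: (simplex_dist_le1 i (xs t) sl).
move=> Tt; apply: (@le_trans _ _ ((ka + 1) * W t)); last first.
  by rewrite -mulrA ler_wpM2l ?MP //; lra.
have at_l := aW t Tt; have yt := yW t; have Wt := W0 t; have yt0 := y0 t.
rewrite -/x two_node_pointE mulrDl mul1r; have [->|i_0] := eqVneq i o0.
  by rewrite -/(a t); lra.
have iy : i \notin S -> x t i 0 <= y t.
  move=> iS; rewrite /y (bigD1 i) //= lerDl sumr_ge0 // => k _.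
  exact: (xs t).1.
have [->|i_1] := eqVneq i o1; last first.
  rewrite subr0 ger0_norm; last exact: (xs t).1.
  have := iy _; rewrite notin_two_nodes i_0 => /(_ i_1).
  by have := mulr_ge0 ka0 Wt; lra.
have yE : y t = 1 - x t o0 0 - x t o1 0.
  rewrite /y (eq_bigl _ _ notin_two_nodes).
  by have := (xs t).2; rewrite sum_two_nodes; lra.
have -> : x t o1 0 - (1 - l) = - (a t - l) - y t by rewrite yE /a; ring.
by apply: le_trans (ler_normB _ _) _; rewrite normrN (ger0_norm yt0); lra.
Qed.

End TwoNodes.

(** * Recurrent class with at least three nodes *)

Section AtLeastThree.
Variables (R : realType) (n : nat) (C : 'M[R]_n).
Hypothesis Cstoch : row_stochastic C.
Let S := globally_reachable_nodes (digraph C).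
Variable i0 : 'I_n.
Hypothesis i0S : i0 \in S.
Variable c : 'cV[R]_n.
Hypothesis cdom : dominant_left_eigenvector C c.
Hypothesis S3 : (2 < #|S|)%N.

Lemma centrality_rivals k i : k \in S -> c k 0 = 2^-1 -> i != k -> c i 0 < 2^-1.
Proof.
move=> kS ck ik; have [l lS] : exists2 l, l \in S & l \notin [set i; k]%SET.
  apply/subsetPn; apply: contraL S3 => /subset_leq_card.
  by rewrite -leqNgt cards2 => /leq_trans; apply; case: (i != k).
rewrite !inE negb_or => /andP[li lk].
have := simplex_others k cdom.2; rewrite (bigD1 i) //= (bigD1 l) ?lk //=.
set rest := \sum_(_ | _) _; have cl := centrality_gt0 Cstoch cdom lS.
have : 0 <= rest by apply: sumr_ge0 => j _; exact: cdom.2.1.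
by rewrite ck; lra.
Qed.

Variable y : 'cV[R]_n.
Hypotheses (ys : simplex y) (yn : ~ autocratic y).

(** A node of centrality 1/2 leaves no room for a non-autocratic equilibrium, and
    the autocratic configurations of all other nodes repel. *)
Lemma autocratic_limit k : k \in S -> c k 0 = 2^-1 ->
  equilibria C = autocratic `|` [set delta_mx k 0] /\
  forall x0, simplex x0 -> ~ autocratic x0 ->
    self_weights C x0 @ \oo --> (delta_mx k 0 : 'cV[R]_n).
Proof.
move=> kS ck.
have aut z : simplex z -> DF_map C z = z -> autocratic z.
  move=> zs Fz; apply: contrapT => zn.
  by have := fixed_centrality_lt_half Cstoch i0S cdom zs zn Fz S3 k; rewrite ck ltxx.
split.
  apply/seteqP; split=> [x [xs Fx]|x [[i _ <-]|->]]; first by left; exact: aut.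
    by split; [exact: simplex_delta|exact: DF_delta].
  by split; [exact: simplex_delta|exact: DF_delta].
move=> x0 x0s x0n; apply: entrywise_cvg => j e e0.
have [b b1 [_ conv]] := trapped_limits Cstoch i0S cdom x0s x0n.
apply: conv e0 => z zs Fz zb; have [i _ zE] := aut z zs Fz.
have [<-//|ik] := eqVneq i k; have := zb i; rewrite -zE mxE !eqxx leNgt.
by rewrite b1 // (centrality_rivals kS ck).
Qed.

Hypothesis no_star : forall i, c i 0 < 2^-1.

(** Existence of the equilibrium comes from the orbit of the arbitrary
    configuration [y], which accumulates at a fixed point away from the autocratic
    configurations. *)
Lemma interior_limit : exists xs : 'cV[R]_n,
  [/\ simplex xs, ~ autocratic xs, DF_map C xs = xs,
      equilibria C = autocratic `|` [set xs] &
      forall x0, simplex x0 -> ~ autocratic x0 ->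
        converges_exponentially (self_weights C x0) xs].
Proof.
have below z (b : 'I_n -> R) : (forall i, c i 0 < 2^-1 -> b i < 1) ->
    simplex z -> (forall i, z i 0 <= b i) -> ~ autocratic z.
  move=> b1 zs zb; apply/(autocraticP zs) => i.
  exact: le_lt_trans (zb i) (b1 i (no_star i)).
have [b b1 [[xs [xss Fxs xsb]] _]] := trapped_limits Cstoch i0S cdom ys yn.
have xsn := below _ _ b1 xss xsb.
have uniq z : simplex z -> DF_map C z = z -> ~ autocratic z -> z = xs.
  move=> zs Fz zn.
  exact: (fixed_unique Cstoch i0S cdom S3 zs zn Fz xss xsn Fxs).
exists xs; split=> //.
  apply/seteqP; split=> [x [xxs Fx]|x [[i _ <-]|->]].
  - by have [xa|xn] := pselect (autocratic x); [left|right; apply: uniq].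
  - by split; [exact: simplex_delta|exact: DF_delta].
  - by [].
move=> x0 x0s x0n.
have [b' b1' [_ conv]] := trapped_limits Cstoch i0S cdom x0s x0n.
have [h [h0 hS _ hflow]] := sink_hitting_flow Cstoch i0S.
have [|M [rho [M0 rho01 MP]]] :=
  exponential_rate Cstoch i0S cdom S3 xss xsn Fxs h0 hS hflow x0s.
  move=> j e e0; apply: conv e0 => z zs Fz zb; apply: uniq => //.
  exact: below b1' zs zb.
exact: entrywise_exponential MP.
Qed.

End AtLeastThree.

(** * The theorem *)

Theorem mainTheorem4 (R : realType) (n r : nat) (C : 'M[R]_n)
  (le2r : (2 <= r)%N) (lern : (r <= n)%N)
  (Cstoch : row_stochastic C) (Cred : reducible C)
  (Cdiag : forall i, C i i = 0)
  (Cglob : globally_reachable_nodes (digraph C) = [set i : 'I_n | (i < r)%N]%SET) :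
  let Gr := induced_subgraph (digraph C)
              (globally_reachable_nodes (digraph C)) in
  (r = 2%N ->
     equilibria C = autocratic `|` two_node_family /\
     (forall x0, simplex x0 -> ~ autocratic x0 ->
        exists2 xs, two_node_family xs &
          converges_exponentially (self_weights C x0) xs)) /\
  ((3 <= r)%N ->
     exists xs : 'cV[R]_n,
       [/\ simplex xs,
           equilibria C = autocratic `|` [set xs],
           (forall k, val (val k) = 0%N -> star_topology Gr k ->
              xs = delta_mx (val k) 0 /\
              (forall x0, simplex x0 -> ~ autocratic x0 ->
                 self_weights C x0 @ \oo --> xs)) &
           (~ (exists k, star_topology Gr k) ->
              [/\ ~ autocratic xs,
                  (forall i : 'I_n, (i < r)%N -> 0 < xs i 0),
                  (forall j : 'I_n, (r <= j)%N -> xs j 0 = 0),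
                  (exists2 c, unique (dominant_left_eigenvector C) c &
                     same_ranking xs c) &
                  (forall x0, simplex x0 -> ~ autocratic x0 ->
                     converges_exponentially (self_weights C x0) xs)])]).
Proof.
move=> Gr; set S := globally_reachable_nodes (digraph C) in Cglob Gr *.
have lt1n : (1 < n)%N by apply: leq_trans lern.
pose o0 : 'I_n := Ordinal (ltnW lt1n); pose o1 : 'I_n := Ordinal lt1n.
have inS i : (i \in S) = (i < r)%N by rewrite Cglob inE.
have o0S : o0 \in S by rewrite inS ltnW.
have cardS : #|S| = r.
  have inj : injective (widen_ord lern).
    by move=> a b /(congr1 val) /= ab; apply: val_inj.
  rewrite Cglob -[RHS]card_ord -(card_imset _ inj).
  apply: eq_card => i; rewrite inE; apply/idP/imsetP => [ir|[j _ ->] /=].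
    by exists (Ordinal ir) => //; apply: val_inj.
  exact: ltn_ord.
split=> [r2|r3].
  have SE : S = [set o0; o1]%SET.
    apply/setP => i; rewrite inS r2 !inE -!val_eqE /=.
    by case: (val i) => [|[|]].
  split; first exact: (two_node_equilibria Cstoch Cdiag (o0 := o0) (o1 := o1)).
  move=> x0; exact: (two_node_convergence Cstoch Cdiag (o0 := o0) (o1 := o1)).
have S3 : (2 < #|S|)%N by rewrite cardS.
have [c cdom] := dominant_left_eigenvector_exists Cstoch o0.
have half01 : 0 < (2^-1 : R) < 1 by lra.
have half01' : 0 <= (2^-1 : R) <= 1 by lra.
have [[k star]|no_star] := pselect (exists k, star_topology Gr k).
  have ck := star_centrality Cstoch Cdiag o0S cdom star.
  have [eqs conv] := autocratic_limit Cstoch o0S cdom S3 (valP k) ck.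
  exists (delta_mx (val k) 0); split=> //; first exact: simplex_delta.
    move=> k' _ star'; suff <- : k = k' by [].
    apply/val_inj/eqP; apply/negPn/negP => kk'.
    have ck' := star_centrality Cstoch Cdiag o0S cdom star'.
    have := centrality_rivals Cstoch cdom S3 (valP k') ck' kk'.
    by rewrite ck ltxx.
  by case; exists k.
have small i : c i 0 < 2^-1.
  have [iS|iS] := boolP (i \in S); last first.
    by rewrite (dominant_off_sink Cstoch o0S cdom iS); lra.
  rewrite ltNge; apply/negP => ci; apply: no_star.
  by exists (Sub i iS); apply: (half_centrality_star Cstoch Cdiag cdom); rewrite SubK.
have o01 : o0 != o1 by [].
have [xs [xss xsn Fxs eqs conv]] := interior_limit Cstoch o0S cdom S3
  (two_node_simplex (o0 := o0) (o1 := o1) erefl erefl half01')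
  (interior_point_nonautocratic (o0 := o0) (o1 := o1) erefl erefl half01) small.
exists xs; split=> // [k _ star|_]; first by case: no_star; exists k.
split=> //.
- by move=> i ir; apply: (fixed_sink_gt0 Cstoch o0S cdom xss xsn Fxs); rewrite -/S inS.
- move=> j rj; apply: (fixed_off_sink Cstoch o0S cdom xss xsn Fxs).
  by rewrite -/S inS -leqNgt.
exists c; first exact: dominant_left_eigenvector_unique o0S cdom.
move=> i j; have [iS|iS] := boolP (i \in S).
  by rewrite (fixed_ranking Cstoch o0S cdom xss xsn Fxs S3 j iS).
rewrite (fixed_off_sink Cstoch o0S cdom xss xsn Fxs iS).
rewrite (dominant_off_sink Cstoch o0S cdom iS) !ltNge.
by rewrite xss.1 cdom.2.1.
Qed.
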